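(* Let $V=\mathbb{R}^d$ be equipped with a non-degenerate symmetric bilinear form $\langle-,-\rangle$, and let $k\ge d+2$. For weights $\pi_1,\dots,\pi_k>0$ with $\sum_i\pi_i=1$ and means $\mu_1,\dots,\mu_k\in V$, consider \[\rho(x)=\sum_{i=1}^k\frac{\pi_i}{\sqrt{(2\pi)^d}}\,e^{-\frac12\langle x-\mu_i,x-\mu_i\rangle},\] assumed to be a probability density on $V$. Let $x_1,x_2$ be drawn independently according to $\rho$, set $\Delta=\langle x_1-x_2,x_1-x_2\rangle$, and let $r(\Delta)$ be the probability distribution of $\Delta$. Then for generic means $\mu_1,\dots,\mu_k$ (i.e. for $(\mu_1,\dots,\mu_k)$ outside some proper Zariski-closed subset of $V^k$), $\rho$ is uniquely reconstructible from $r$ up to a symmetry of the bilinear form: if $\bar\rho$ is another probability density of the same form (same bilinear form, $k$ components, positive weights summing to $1$) with the same distribution $r$, then there is an affine isometry $g$ of $(V,\langle-,-\rangle)$, i.e. $g(x)=Ax+b$ with $A\in O(V)$ and $b\in V$, such that $\rho(x)=\bar\rho(g\cdot x)$ for all $x\in V$.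
   Context: $O(V)$ denotes the group of linear maps $A:V\to V$ with $\langle Au,Av\rangle=\langle u,v\rangle$ for all $u,v\in V$. *)

(* Defs.v *)
From HB Require Import structures.
From mathcomp Require Import all_boot all_order all_algebra.
From mathcomp Require Import all_classical all_reals all_analysis.
From mathcomp Require mpoly.

Set Implicit Arguments.
Unset Strict Implicit.
Unset Printing Implicit Defensive.

Import Order.TTheory GRing.Theory Num.Theory.
Local Open Scope classical_set_scope.
Local Open Scope ring_scope.

(* V = R^d is represented by row vectors 'rV[R]_d.  A bilinear form on V is
   given by its Gram matrix G : <u, v> = u G v^T.  Symmetric: G^T = G;
   non-degenerate: G invertible. *)
Definition bil (R : realType) (d : nat) (G : 'M[R]_d) (u v : 'rV[R]_d) : R :=
  (u *m G *m v^T) 0 0.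

Definition is_orth (R : realType) (d : nat) (G : 'M[R]_d) (A : 'M[R]_d) : Prop :=
  forall u v : 'rV[R]_d, bil G (u *m A) (v *m A) = bil G u v.

Definition gmix (R : realType) (d k : nat) (G : 'M[R]_d) (w : 'I_k -> R)
  (M : 'M[R]_(k, d)) (x : 'rV[R]_d) : R :=
  \sum_(i < k) w i / Num.sqrt ((2 * pi) ^+ d)
     * expR (- (bil G (x - row i M) (x - row i M)) / 2).

(* Lebesgue integral over R^d of a nonnegative extended-real function,
   written as the iterated Lebesgue integral over the coordinates
   (equal to the integral w.r.t. d-dimensional Lebesgue measure for
   nonnegative measurable integrands, by Tonelli). *)
Fixpoint iint (R : realType) (n : nat) : ('rV[R]_n -> \bar R) -> \bar R :=
  match n with
  | 0 => fun f => f 0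
  | n'.+1 => fun f =>
      (\int[@lebesgue_measure R]_(t in [set: R])
         iint (fun v : 'rV[R]_n' => f (row_mx (const_mx t : 'rV[R]_1) v)))%E
  end.

Definition is_prob_density (R : realType) (d : nat) (rho : 'rV[R]_d -> R) : Prop :=
  (forall x, 0 <= rho x) /\ iint (fun x => (rho x)%:E) = 1%E.

Definition delta_prob (R : realType) (d : nat) (G : 'M[R]_d)
  (rho : 'rV[R]_d -> R) (B : set R) : \bar R :=
  iint (fun x1 => iint (fun x2 =>
    (rho x1 * rho x2 * \1_B (bil G (x1 - x2) (x1 - x2)))%:E)).

Definition same_delta_dist (R : realType) (d : nat) (G : 'M[R]_d)
  (rho rho' : 'rV[R]_d -> R) : Prop :=
  forall B : set R, measurable B -> delta_prob G rho B = delta_prob G rho' B.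

(* Zariski-closed subsets of V^k = R^(k*d): common zero loci of a set S of
   polynomials in k*d variables; a point of V^k is a matrix M : 'M_(k,d)
   (rows = the k points), with coordinates mxvec M. *)
Definition zero_locus (R : realType) (k d : nat)
  (S : set (mpoly.mpoly (k * d) R)) (M : 'M[R]_(k, d)) : Prop :=
  forall p, S p -> mpoly.meval (fun j => mxvec M 0 j) p = 0.

(* Main.v *)
Require Import Defs.
From HB Require Import structures.
From mathcomp Require Import all_boot all_order all_algebra.
From mathcomp Require Import all_classical all_reals all_analysis.
From mathcomp Require Import measurable_realfun.
From mathcomp Require mpoly.
From mathcomp Require Import ring lra zify.
Import (canonicals) mpoly.

(** The Laplace transform of [Delta] at [t] is, up to a factor depending on [t]
    only, [sum_(i,j) w_i w_j exp (- t / (1 + 4 t) lambda_ij)] with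
    [lambda_ij = <mu_i - mu_j, mu_i - mu_j>]; hence [r] determines the multiset of
    the [lambda_ij] weighted by [w_i w_j].  For generic means the [lambda_ij] are
    distinct, so a second mixture with the same [r] has the same distances up to a
    bijection [f] of the edges of the complete graph, and it remains to see that
    generically [f] is induced by a bijection of the vertices.

    If not, some configuration has permuted distances that are not realizable in
    dimension [d], which is a polynomial condition.  Indeed, suppose that the
    linear map [T] permuting squared distances by [f] sends all configurations of
    [R^d] to matrices of (Cayley-Menger) rank at most [d].  As [d < k - 1], such a
    linear map also maps rank at most [r] to rank at most [r] for
    [r = d - 1, ..., 1].  The indicator matrix of a star of edges has rank one, so
    its image is a 0/1 matrix of rank one, that is, a cut; and an edge bijection
    sending stars to cuts comes from a vertex bijection. *)

Set Implicit Arguments.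
Unset Strict Implicit.
Unset Printing Implicit Defensive.

Import Order.TTheory GRing.Theory Num.Theory.
Local Open Scope ring_scope.

(** * Edge maps and the rank of squared distance matrices *)

Section Pencil.
Variable R : realFieldType.

Lemma poly_eq0_inf (p : {poly R}) (g : nat -> R) :
  injective g -> (forall m, root p (g m)) -> p = 0.
Proof.
move=> ginj rp; apply/eqP; apply: contraT => p0.
have := max_poly_roots (rs := [seq g m | m <- iota 0 (size p)]) p0.
rewrite size_map size_iota ltnn; apply.
  by apply/allP => _ /mapP[m _ ->].
by rewrite map_inj_uniq // iota_uniq.
Qed.

(** The determinant of [C + s *: E] is a polynomial in s. It vanishes at the infinitely many squares
    (m + 1)^2, hence everywhere, in particular at s = 0. *)
Lemma det_pencil0 n (C E : 'M[R]_n) :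
  (forall t : R, t != 0 -> \det (C + t ^+ 2 *: E) = 0) -> \det C = 0.
Proof.
move=> H; pose p := \det (map_mx polyC C + 'X *: map_mx polyC E).
have pE t : p.[t] = \det (C + t *: E).
  rewrite /p -[LHS]/(horner_eval t _) -det_map_mx; congr (\det _).
  by apply/matrixP=> i j; rewrite !mxE -[LHS]/(((C i j)%:P + 'X * (E i j)%:P).[t]) !hornerE.
have p0 : p = 0.
  apply: (@poly_eq0_inf _ (fun m => m.+1%:R ^+ 2)).
    move=> m n' /eqP; rewrite eqrXn2 ?ler0n // eqr_nat => /eqP [] //.
  by move=> m; apply/rootP; rewrite pE H // pnatr_eq0.
by have := pE 0; rewrite p0 horner0 scale0r addr0 => <-.
Qed.

Lemma det_mx22 (A : 'M[R]_2) : \det A = A 0 0 * A 1 1 - A 0 1 * A 1 0.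
Proof.
rewrite (expand_det_row _ 0) !big_ord_recl big_ord0 addr0 /cofactor !det_mx11 !mxE /=.
rewrite !addn0 expr0 expr1 mul1r mulN1r mulrN.
by congr (A _ _ * A _ _ - A _ _ * A _ _); apply/val_inj.
Qed.

End Pencil.

Definition pull_mx (T : Type) k (f : 'I_k * 'I_k -> 'I_k * 'I_k) (D : 'M[T]_k) : 'M[T]_k :=
  \matrix_(i, j) D (f (i, j)).1 (f (i, j)).2.

Definition ends k (p : 'I_k * 'I_k) : {set 'I_k} := [set p.1; p.2].

Section EdgeMaps.
Variables (R : realFieldType) (k : nat).
Implicit Types (D : 'M[R]_k) (x y : 'I_k -> R).

Definition sqdist_mx x : 'M[R]_k := \matrix_(i, j) (x i - x j) ^+ 2.

(* For D the squared distances of points x_i, the matrix P D Q is -2 times a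
   product of P, the Gram matrix of the x_i, and Q: the condition says that the
   points span an affine space of dimension less than m. *)
Definition edm_rank_lt m D := forall (P : 'M[R]_(m, k)) (Q : 'M[R]_(k, m)),
  P *m const_mx 1 = 0 :> 'cV_m -> const_mx 1 *m Q = 0 :> 'rV_m ->
  \det (P *m D *m Q) = 0.

Variable f : 'I_k * 'I_k -> 'I_k * 'I_k.

Local Notation pull_mx := (pull_mx f).


Hypothesis f_diag : forall i, (f (i, i)).1 = (f (i, i)).2.
Hypothesis f_ndiag : forall i j, i != j -> (f (i, j)).1 != (f (i, j)).2.
Hypothesis f_sym : forall i j, ends (f (i, j)) = ends (f (j, i)).
Hypothesis f_inj : forall i j i' j', i != j -> i' != j' ->
  ends (f (i, j)) = ends (f (i', j')) -> ends (i, j) = ends (i', j').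

Lemma pull_mxD D1 D2 : pull_mx (D1 + D2) = pull_mx D1 + pull_mx D2.
Proof. by apply/matrixP => i j; rewrite !mxE. Qed.

Lemma pull_mxZ a D : pull_mx (a *: D) = a *: pull_mx D.
Proof. by apply/matrixP => i j; rewrite !mxE. Qed.

Lemma ends_eqE (i j a b : 'I_k) : i != j ->
  (ends (i, j) == ends (a, b)) = ((i == a) && (j == b)) || ((i == b) && (j == a)).
Proof.
move=> ij; apply/eqP/orP => [/finset.setP E|[/andP[/eqP-> /eqP->]|/andP[/eqP-> /eqP->]]] //.
- have := E i; have := E j; have := E a; have := E b; rewrite !inE !eqxx ?orbT /=.
  move: ij; rewrite (eq_sym b i) (eq_sym b j) (eq_sym a i) (eq_sym a j).
  case: (i =P a) => [->|_]; case: (j =P b) => [->|_] //=; rewrite ?eqxx ?orbT /=; auto.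
  + by move=> aj; rewrite (eq_sym j a) (negbTE aj) /=; case: (j == b).
  + by move=> ib; rewrite (negbTE ib).
  by case: (i == b) => //=; case: (j == a) => //; auto.
- by rewrite /ends /= finset.setUC.
Qed.

(* u_i v_j + u_j v_i = 0 summed over j <> i gives u_i v_i = 0. *)
Lemma kernel_contra (u : 'rV[R]_k) (v : 'cV[R]_k) :
  u *m const_mx 1 = 0 :> 'M[R]_1 -> const_mx 1 *m v = 0 :> 'M[R]_1 ->
  (forall y, u *m pull_mx (sqdist_mx y) *m v = 0) -> u = 0 \/ v = 0.
Proof.
move=> u1 v1 H.
pose e (a : 'I_k) := fun i : 'I_k => (i == a)%:R : R.
have uv i j : i != j -> u 0 i * v j 0 + u 0 j * v i 0 = 0.
  move=> ij; set a := (f (i, j)).1; set b := (f (i, j)).2.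
  have ab : a != b by exact: f_ndiag.
  (* Polarization: D(x) + D(y) - D(x + y) has entries -2 (x_i - x_j)(y_i - y_j). For the indicators
     of [a] and [b] this is 2 at (a, b) and (b, a) and 0 elsewhere, and only the edge ij is sent to
     ab. *)
  have HE : u *m pull_mx (sqdist_mx (e a) + sqdist_mx (e b)
      + (-1) *: sqdist_mx (fun l => e a l + e b l)) *m v = 0.
    by rewrite !pull_mxD pull_mxZ !mulmxDr -scalemxAr !mulmxDl -scalemxAl !H scaler0 !addr0.
  have PE : pull_mx (sqdist_mx (e a) + sqdist_mx (e b)
      + (-1) *: sqdist_mx (fun l => e a l + e b l)) = 2 *: (delta_mx i j + delta_mx j i).
    apply/matrixP => i' j'; rewrite !mxE /e.
    have [<-|ij'] := eqVneq i' j'.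
      rewrite f_diag !subrr expr0n /= mulr0 !addr0.
      case: (i' =P i) => [->|_] /=; first by rewrite (negbTE ij) /= addr0 mulr0.
      by rewrite andbF addr0 mulr0.
    have E : (ends (f (i', j')) == ends (f (i, j))) = (ends (i', j') == ends (i, j)).
      apply/eqP/eqP; first exact: f_inj.
      move/eqP; rewrite ends_eqE // => /orP[/andP[/eqP-> /eqP->]|/andP[/eqP-> /eqP->]] //.
    have := f_ndiag ij'.
    move: E; rewrite [f (i',j')]surjective_pairing [f (i,j)]surjective_pairing -/a -/b.
    move: (f (i',j')).1 (f (i',j')).2 => p q /= E pq.
    move: E; rewrite !ends_eqE //.
    have c1 : ~~ ((p == a) && (p == b)) by apply: contra ab => /andP[/eqP<- /eqP<-].
    have c2 : ~~ ((q == a) && (q == b)) by apply: contra ab => /andP[/eqP<- /eqP<-].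
    have c3 : ~~ ((p == a) && (q == a)) by apply: contra pq => /andP[/eqP-> /eqP->].
    have c4 : ~~ ((p == b) && (q == b)) by apply: contra pq => /andP[/eqP-> /eqP->].
    have c5 : ~~ ((i' == i) && (i' == j)) by apply: contra ij => /andP[/eqP<- /eqP<-].
    move: c1 c2 c3 c4 c5.
    case: (p == a); case: (q == a); case: (p == b); case: (q == b) => //= _ _ _ _;
      case: (i' == i); case: (i' == j) => //=;
      case: (j' == i); case: (j' == j) => //= _ _; ring.
  move: HE; rewrite PE -scalemxAr -scalemxAl => /eqP.
  rewrite scaler_eq0 pnatr_eq0 /= => /eqP /matrixP /(_ 0 0).
  rewrite mulmxDr mulmxDl !mxE => <-; congr (_ + _).
    rewrite (bigD1 j) //= big1 ?addr0 => [|l lj].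
      rewrite !mxE (bigD1 i) //= big1 ?addr0 ?mxE ?eqxx ?mulr1 // => l li.
      by rewrite mxE (negbTE li) mulr0.
    rewrite !mxE big1 ?mul0r // => l' _; by rewrite mxE (negbTE lj) andbF mulr0.
  rewrite (bigD1 i) //= big1 ?addr0 => [|l lj].
    rewrite !mxE (bigD1 j) //= big1 ?addr0 ?mxE ?eqxx ?mulr1 // => l li.
    by rewrite mxE (negbTE li) mulr0.
  rewrite !mxE big1 ?mul0r // => l' _; by rewrite mxE (negbTE lj) andbF mulr0.
have su : \sum_i u 0 i = 0.
  move/matrixP: u1 => /(_ 0 0); rewrite !mxE => h; rewrite -[RHS]h.
  by apply: eq_bigr => i _; rewrite mxE mulr1.
have sv : \sum_i v i 0 = 0.
  move/matrixP: v1 => /(_ 0 0); rewrite !mxE => h; rewrite -[RHS]h.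
  by apply: eq_bigr => i _; rewrite mxE mul1r.
have uvi i : u 0 i * v i 0 = 0.
  have : \sum_(j | j != i) (u 0 i * v j 0 + u 0 j * v i 0) = 0.
    by rewrite big1 // => j ji; rewrite uv // eq_sym.
  rewrite big_split /= -mulr_sumr -mulr_suml.
  have -> : \sum_(j | j != i) v j 0 = - v i 0.
    by apply/eqP; have := sv; rewrite (bigD1 i) //= addrC => /eqP; rewrite addr_eq0.
  have -> : \sum_(j | j != i) u 0 j = - u 0 i.
    by apply/eqP; have := su; rewrite (bigD1 i) //= addrC => /eqP; rewrite addr_eq0.
  by move=> h; lra.
have [->|/rV0Pn[i ui]] := eqVneq u 0; [by left|right].
apply/matrixP => j l; rewrite !mxE (ord1 l).
have vi : v i 0 = 0 by move/eqP: (uvi i); rewrite mulf_eq0 (negbTE ui) /= => /eqP.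
have [->//|ji] := eqVneq j i.
have := uv i j; rewrite eq_sym => /(_ ji) /eqP.
by rewrite vi mulr0 addr0 mulf_eq0 (negbTE ui) => /eqP.
Qed.

Lemma wide_kernel m (N : 'M[R]_(k, m)) : (m < k)%N ->
  exists2 u : 'rV[R]_k, u != 0 & u *m N = 0.
Proof.
move=> mk; have : kermx N != 0.
  by rewrite kermx_eq0 /row_free neq_ltn (leq_ltn_trans (rank_leq_col N) mk).
case/rowV0Pn => u /sub_kermxP uN u0; by exists u.
Qed.

(* If P, Q witness that [pull_mx A] has rank r + 1, border P, Q by kernel vectors
   u, v.  The determinant of the bordered [pull_mx (A + t y)] vanishes for all t,
   and its coefficient of t yields u (pull_mx y) v = 0 for every y, which is
   excluded by [kernel_contra]. *)
Lemma edm_rank_descent r A c : (r.+2 < k)%N -> c != 0 ->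
  (forall y, edm_rank_lt r.+2 (pull_mx (A + c *: sqdist_mx y))) ->
  edm_rank_lt r.+1 (pull_mx A).
Proof.
move=> rk c0 H P Q P1 Q1; apply/eqP; apply: contraT => detN.
set B := pull_mx A in detN.
have [u u0 /eqP] := @wide_kernel (1 + r.+1) (row_mx (const_mx 1) (B *m Q)) rk.
rewrite mul_mx_row -row_mx0 => /eqP/eq_row_mx[u1 uBQ].
have [v' v0 /eqP] := @wide_kernel (1 + r.+1) (row_mx (const_mx 1) ((P *m B)^T)) rk.
rewrite mul_mx_row -row_mx0 => /eqP/eq_row_mx[v1 vPB].
pose v := v'^T.
have v1' : const_mx 1 *m v = 0 :> 'M[R]_1.
  by rewrite /v -trmx_const -trmx_mul v1 trmx0.
have PBv : P *m B *m v = 0 by rewrite /v -(trmxK (P *m B)) -trmx_mul vPB trmx0.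
have key y : \det (P *m B *m Q) * (u *m pull_mx (sqdist_mx y) *m v) 0 0 = 0.
  set Y := pull_mx (sqdist_mx y).
  have big t : \det (col_mx P u *m (B + (c * t ^+ 2) *: Y) *m row_mx Q v) = 0.
    have := H (fun i => t * y i); rewrite -addn1 => H'.
    have -> : B + (c * t ^+ 2) *: Y = pull_mx (A + c *: sqdist_mx (fun i => t * y i)).
      rewrite pull_mxD pull_mxZ; apply/matrixP => i j; rewrite !mxE.
      ring.
    apply: H'; first by rewrite mul_col_mx P1 u1 col_mx0.
    by rewrite mul_mx_row Q1 v1' row_mx0.
  have uBv0 : u *m B *m v = 0.
    have := big 0; rewrite expr0n mulr0 scale0r addr0 mul_col_mx mul_col_row PBv.
    rewrite -(mulmxA u B Q) uBQ det_ublock det_mx11 => /eqP.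
    rewrite mulf_eq0 (negbTE detN) /= => /eqP h.
    by apply/matrixP => i j; rewrite !ord1 h mxE.
  pose Y' := c *: Y.
  (* By [uBv0] and [PBv] the last column of the bordered matrix is divisible by t^2. Dividing it out
     leaves a pencil in t^2, whose value at 0 is block triangular by [uBQ]. *)
  have : \det (block_mx (P *m B *m Q) (P *m Y' *m v) 0 (u *m Y' *m v)) = 0.
    apply: (@det_pencil0 _ _ _ (block_mx (P *m Y' *m Q) 0 (u *m Y' *m Q) 0)) => t t0.
    have t20 : t ^+ 2 != 0 by rewrite expf_eq0.
    apply: (mulIf t20); rewrite mul0r -(big t).
    rewrite scale_block_mx add_block_mx !scaler0 !addr0.
    transitivity (\det (block_mx (P *m B *m Q + t ^+ 2 *: (P *m Y' *m Q)) (P *m Y' *m v)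
       (0 + t ^+ 2 *: (u *m Y' *m Q)) (u *m Y' *m v) *m
         block_mx 1%:M 0 0 ((t ^+ 2)%:M : 'M[R]_1))).
      by rewrite det_mulmx det_ublock det1 mul1r det_scalar1.
    rewrite mulmx_block; congr (\det _).
    rewrite mul_col_mx mul_col_row !mulmx0 !mulmx1 !add0r !addr0 !mul_mx_scalar.
    rewrite !mulmxDr !mulmxDl uBv0 PBv -(mulmxA u B Q) uBQ !add0r.
    have -> : (c * t ^+ 2) *: Y = t ^+ 2 *: Y' by rewrite /Y' scalerA mulrC.
    by rewrite -!scalemxAr -!scalemxAl.
  rewrite det_ublock det_mx11 /Y' -scalemxAr -scalemxAl mxE => /eqP.
  by rewrite mulrCA mulf_eq0 (negbTE c0) => /eqP.
have uv0 : u = 0 \/ v = 0.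
  apply: (kernel_contra u1 v1') => y; apply/matrixP => i j; rewrite !ord1; have /eqP := key y.
  by rewrite mulf_eq0 (negbTE detN) /= => /eqP->; rewrite mxE.
case: uv0 => [u00|v00]; first by rewrite u00 eqxx in u0.
by move: v0; rewrite -(trmxK v') -/v v00 trmx0 eqxx.
Qed.

(** Each use of [edm_rank_descent] removes the last summand, whose points are arbitrary, and lowers
    the rank bound by one, until a multiple of [sqdist_mx y] is left. The [c s] may have either
    sign, so indefinite forms are covered. *)
Lemma edm_rank_one d (c : nat -> R) : (0 < d)%N -> (d.+1 < k)%N ->
  (forall s, (s < d)%N -> c s != 0) ->
  (forall x : nat -> 'I_k -> R,
    edm_rank_lt d.+1 (pull_mx (\sum_(s < d) c s *: sqdist_mx (x s)))) ->
  forall y, edm_rank_lt 2 (pull_mx (sqdist_mx y)).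
Proof.
case: d => // d _; elim: d => [|d IH] dk c0 H y.
  move=> P Q P1 Q1; have := H (fun=> y) P Q P1 Q1.
  rewrite big_ord1 pull_mxZ -scalemxAr -scalemxAl detZ => /eqP.
  by rewrite mulf_eq0 expf_eq0 (negbTE (c0 0 _)) // => /eqP.
apply: IH => [|s sd|x]; [exact: ltnW|by apply: c0; rewrite ltnS ltnW|].
apply: (@edm_rank_descent _ _ (c d.+1)) => [//||z]; first exact: c0.
have := H (fun s => if s == d.+1 then z else x s).
rewrite big_ord_recr /= eqxx; under eq_bigr => i _ do rewrite (ltn_eqF (ltn_ord i)).
by [].
Qed.

(** One point at 1 and all others at 0: the squared distance matrix is the indicator of the star of
    edges at [a]. *)
Definition indic_fun (a : 'I_k) : 'I_k -> R := fun i => (i == a)%:R.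

Lemma pull_star a i j : i != j ->
  pull_mx (sqdist_mx (indic_fun a)) i j = (a \in ends (f (i, j)))%:R.
Proof.
move=> ij; rewrite !mxE inE !inE /indic_fun; have := f_ndiag ij.
rewrite ![a == _]eq_sym; move: (f (i, j)).1 (f (i, j)).2 => p q pq.
have : ~~ ((p == a) && (q == a)) by apply: contra pq => /andP[/eqP-> /eqP->].
by case: (p == a); case: (q == a) => //= _; ring.
Qed.

Lemma pull_star_diag a i : pull_mx (sqdist_mx (indic_fun a)) i i = 0.
Proof. by rewrite !mxE f_diag subrr expr0n. Qed.

(* A 0/1 squared distance matrix of rank one is the indicator of a cut. *)
Lemma star_xor a i j l : edm_rank_lt 2 (pull_mx (sqdist_mx (indic_fun a))) ->
  i != j -> i != l -> l != j ->
  (a \in ends (f (i, j))) = (a \in ends (f (i, l))) (+) (a \in ends (f (l, j))).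
Proof.
set D := pull_mx _ => H ij il lj.
pose v (t : 'I_2) := if t == 0 then i else j.
pose P : 'M[R]_(2, k) := \matrix_(t, b) ((b == v t)%:R - (b == l)%:R).
have PE t : row t P = delta_mx 0 (v t) - delta_mx 0 l.
  by apply/matrixP => x b; rewrite !mxE ord1 eqxx.
have P1 : P *m const_mx 1 = 0 :> 'cV_2.
  apply/matrixP => t b; rewrite !mxE; under eq_bigr => z _ do rewrite !mxE mulr1.
  rewrite sumrB (bigD1 (v t)) //= eqxx big1 => [|z /negbTE->//].
  by rewrite (bigD1 l) //= eqxx big1 ?subrr // => z /negbTE->.
have P1T : const_mx 1 *m P^T = 0 :> 'rV_2.
  by rewrite -[const_mx 1]trmx_const -trmx_mul P1 trmx0.
have E t1 t2 : (P *m D *m P^T) t1 t2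
    = D (v t1) (v t2) - D l (v t2) - (D (v t1) l - D l l).
  have -> : (P *m D *m P^T) t1 t2 = (row t1 P *m D *m (row t2 P)^T) 0 0.
    by rewrite -row_mul tr_row !mxE; apply: eq_bigr => z _; rewrite !mxE.
  rewrite !PE mulmxBl -!rowE linearB /= !trmx_delta mulmxBr -!colE.
  by rewrite !mxE.
(* With x, y, z the entries of [D] at ij, il, lj, the vanishing determinant says 4 y z = (x - y -
   z)^2, whose 0/1 solutions are exactly x = y xor z. *)
have := H P P^T P1 P1T; rewrite det_mx22 !E /v /= !/D !pull_star_diag.
rewrite !pull_star // 1?eq_sym // (f_sym j i) (f_sym l i) (f_sym j l) => /eqP.
case: (a \in ends (f (i, j))); case: (a \in ends (f (i, l)));
  case: (a \in ends (f (l, j))) => //= /eqP; lra.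
Qed.

Lemma card_ends i j : i != j -> #|ends (f (i, j))| = 2%N.
Proof. by move=> ij; rewrite finset.cards2 f_ndiag. Qed.

(* By [star_xor], the images of the edges at i0 pairwise meet in one vertex; by
   injectivity they form a star, not a triangle. *)
Lemma edge_map_vertex : (2 < k)%N ->
  (forall a, edm_rank_lt 2 (pull_mx (sqdist_mx (indic_fun a)))) ->
  exists2 t : 'I_k -> 'I_k, injective t &
    forall i j, i != j -> ends (f (i, j)) = [set t i; t j].
Proof.
move=> k2 H; pose F i j := ends (f (i, j)).
have Fxor a i j l : i != j -> i != l -> l != j ->
  (a \in F i j) = (a \in F i l) (+) (a \in F l j) by move=> *; exact: star_xor.
have Fs i j : F i j = F j i by exact: f_sym.
have k0 : (0 < k)%N by lia. have k1 : (1 < k)%N by lia.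
pose i0 := Ordinal k0; pose j1 := Ordinal k1; pose j2 := Ordinal k2.
(* The two-element set [F i j] is the symmetric difference of the two-element sets [F i0 i] and
   [F i0 j], so these share exactly one point. *)
have Fcap i j : i != i0 -> j != i0 -> i != j -> #|F i0 i :&: F i0 j| = 1%N.
  move=> ii ji ij.
  have := card_ends ij; rewrite -[ends _]/(F i j).
  have -> : F i j = (F i0 i :\: F i0 j) :|: (F i0 j :\: F i0 i).
    apply/finset.setP => a; rewrite (Fxor _ _ _ i0) // 1?eq_sym //.
    rewrite (Fs i i0); move: (F i0 i) (F i0 j) => A B; rewrite !inE.
    by case: (a \in A); case: (a \in B).
  rewrite finset.cardsU; have -> : (F i0 i :\: F i0 j) :&: (F i0 j :\: F i0 i) = finset.set0.
    apply/finset.setP => a; move: (F i0 i) (F i0 j) => A B; rewrite !inE.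
    by case: (a \in A); case: (a \in B).
  rewrite finset.cards0 !finset.cardsD (finset.setIC (F i0 j)) /F !card_ends // 1?eq_sym //.
  have : (#|ends (f (i0, i)) :&: ends (f (i0, j))| <= 2)%N.
    by rewrite -(@card_ends i0 i) 1?eq_sym // subset_leq_card // finset.subsetIl.
  lia.
have [a Ea] : exists a, F i0 j1 :&: F i0 j2 = [set a].
  by apply/cards1P/eqP; apply: Fcap.
have aj1 : a \in F i0 j1 by have := finset.set11 a; rewrite -Ea inE => /andP[].
have aj2 : a \in F i0 j2 by have := finset.set11 a; rewrite -Ea inE => /andP[].
have other j : j != i0 -> a \in F i0 j ->
    exists2 b, b != a & F i0 j = [set a; b].
  move=> ji aj; have /cards1P[b Eb] : #|F i0 j :\ a| == 1%N.
    by have := finset.cardsD1 a (F i0 j); rewrite aj /F card_ends 1?eq_sym // add1n => -[<-].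
  exists b; first by have := finset.set11 b; rewrite -Eb !inE => /andP[].
  by rewrite -(finset.setD1K aj) Eb.
(* The triangle case: an image [F i0 j] avoiding [a] meets both {a, b1} and {a, b2}, so it equals
   {b1, b2}; but this is [F j1 j2], against injectivity. *)
have aall j : j != i0 -> a \in F i0 j.
  move=> ji; have [->//|jj1] := eqVneq j j1; have [->//|jj2] := eqVneq j j2.
  apply: contraT => aj.
  have [b1 b1a E1] := other j1 isT aj1; have [b2 b2a E2] := other j2 isT aj2.
  have b12 : b1 != b2.
    apply/eqP => b12; have := Fcap j1 j2 isT isT isT.
    by rewrite E1 E2 b12 finset.setIid finset.cards2 eq_sym b2a.
  have bj i b : i != i0 -> j != i -> F i0 i = [set a; b] -> b \in F i0 j.
    move=> ii jin Ei; have := Fcap j i ji ii jin.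
    move/eqP/cards1P => [c Ec]; have := finset.set11 c; rewrite -Ec Ei finset.in_setI finset.in_set2.
    case/andP => cj /orP[|] /eqP cE; last by rewrite -cE.
    by move: aj; rewrite -cE cj.
  have EF : F i0 j = [set b1; b2].
    apply/eqP; rewrite eq_sym eqEcard finset.subUset !finset.sub1set (bj j1) // (bj j2) //=.
    by rewrite /F card_ends 1?eq_sym // finset.cards2 b12.
  have EF' : F i0 j = F j1 j2.
    apply/finset.setP => c; rewrite (Fxor _ j1 j2 i0) // (Fs j1) E1 E2 EF !inE.
    have [->|ca] := eqVneq c a; first by rewrite ![a == _]eq_sym (negbTE b1a) (negbTE b2a).
    by have [->|] := eqVneq c b1; rewrite ?(negbTE b12).
  have /eqP : ends (i0, j) = ends (j1, j2) by apply: f_inj EF' => //; rewrite eq_sym.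
  by rewrite ends_eqE 1?eq_sym // => /orP[] /andP[/eqP].
(* [i0] goes to the common vertex [a], and any other [j] to the second end of [F i0 j]; the default
   of [odflt] is never taken. *)
pose t j := if j == i0 then a else odflt a [pick b | (b != a) && (b \in F i0 j)].
have tE j : j != i0 -> t j != a /\ F i0 j = [set a; t j].
  move=> ji; have [b ba Fb] := other j ji (aall j ji).
  rewrite /t (negbTE ji); case: pickP => [c|/(_ b)] /=.
    by rewrite Fb finset.in_set2 => /andP[ca]; rewrite (negbTE ca) /= => /eqP cb; rewrite -cb.
  by rewrite Fb finset.in_set2 eqxx orbT ba.
have t0 : t i0 = a by rewrite /t eqxx.
have FE i j : i != j -> F i j = [set t i; t j].
  move=> ij; have [ii|ii] := eqVneq i i0.
    have ji : j != i0 by rewrite -ii eq_sym.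
    by rewrite ii t0; have [_ ->] := tE j ji.
  have [ji|ji] := eqVneq j i0.
    have [_ ] := tE i ii; rewrite /F f_sym ji t0 => ->; exact: finset.setUC.
  have [tia Fi] := tE i ii; have [tja Fj] := tE j ji.
  have tij : t i != t j.
    apply/eqP => E; have := Fcap i j ii ji ij.
    by rewrite Fi Fj E finset.setIid finset.cards2 eq_sym tja.
  apply/finset.setP => c; rewrite (Fxor _ i j i0) // 1?eq_sym // (Fs i).
  rewrite Fi Fj !inE.
  have [->|ca] := eqVneq c a; first by rewrite ![a == _]eq_sym (negbTE tia) (negbTE tja).
  by have [->|] := eqVneq c (t i); rewrite ?(negbTE tij).
exists t => // i j tij; apply: contraTeq isT => ij.
by have := card_ends ij; rewrite -/(F i j) FE // tij finset.cards2 eqxx.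
Qed.

End EdgeMaps.

(** * Squared distances for a bilinear form *)

(** The ring is arbitrary so that the formula also applies to a matrix of indeterminates, which
    turns conditions on distances into polynomials. *)
Definition dist_mx (S : comNzRingType) d k (G : 'M[S]_d) (M : 'M[S]_(k, d)) : 'M[S]_k :=
  \matrix_(i, j) ((row i M - row j M) *m G *m (row i M - row j M)^T) 0 0.

Section DistMx.
Variables (S : comNzRingType) (d k : nat) (G : 'M[S]_d).
Implicit Types (M : 'M[S]_(k, d)).

(** Bilinear expansion of <x_i - x_j, x_i - x_j>. The first two terms have constant rows or columns,
    so factors with zero sums kill them, and only the Gram part survives in [mul_dist_mx]. *)
Lemma dist_mxE M : dist_mx G M =
  (\col_i (M *m G *m M^T) i i) *m const_mx 1 + const_mx 1 *m (\row_j (M *m G *m M^T) j j)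
  - M *m (G + G^T) *m M^T.
Proof.
apply/matrixP => i j.
have E i' j' : (M *m G *m M^T) i' j' = (row i' M *m G *m (row j' M)^T) 0 0.
  by rewrite -row_mul tr_row !mxE; apply: eq_bigr => z _; rewrite !mxE.
have T : M *m G^T *m M^T = (M *m G *m M^T)^T by rewrite !trmx_mul trmxK mulmxA.
rewrite mulmxDr mulmxDl T; set A := M *m G *m M^T in E *.
have -> : (\col_l A l l) *m const_mx 1 = (\matrix_(i < k, j < k) A i i).
  by apply/matrixP => x y; rewrite !mxE big_ord1 !mxE mulr1.
have -> : const_mx 1 *m (\row_l A l l) = (\matrix_(i < k, j < k) A j j).
  by apply/matrixP => x y; rewrite !mxE big_ord1 !mxE mul1r.
rewrite [LHS]mxE linearB /= mulmxBr !mulmxBl.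
transitivity (A i i - A j i - (A i j - A j j)); first by rewrite !E !mxE.
rewrite !mxE; ring.
Qed.

Lemma mul_dist_mx m n (P : 'M[S]_(m, k)) (Q : 'M[S]_(k, n)) M :
  P *m const_mx 1 = 0 :> 'cV_m -> const_mx 1 *m Q = 0 :> 'rV_n ->
  P *m dist_mx G M *m Q = - (P *m M *m (G + G^T) *m (M^T *m Q)).
Proof.
move=> P1 Q1; rewrite dist_mxE mulmxBr mulmxBl mulmxDr mulmxDl.
rewrite !mulmxA P1 !mul0mx -!mulmxA Q1 !mulmx0 addr0 add0r.
by rewrite !mulmxA.
Qed.

Lemma map_dist_mx (S' : comNzRingType) (phi : {rmorphism S -> S'}) M :
  map_mx phi (dist_mx G M) = dist_mx (map_mx phi G) (map_mx phi M).
Proof.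
apply/matrixP => i j; rewrite 2!mxE [RHS]mxE -!map_row -map_mxB map_trmx -!map_mxM.
by rewrite [RHS]mxE.
Qed.

End DistMx.

Section FormAlgebra.
Variables (R : realFieldType) (d : nat) (G : 'M[R]_d).
Hypotheses (Gsym : G^T = G) (Gunit : G \in unitmx).

(** The product factors through R^d, so this square matrix of size d + 1 is singular. *)
Lemma dist_mx_rank k (M : 'M[R]_(k, d)) : edm_rank_lt d.+1 (dist_mx G M).
Proof.
move=> P Q P1 Q1; rewrite mul_dist_mx // -mulmxN -(mulmxA (P *m M)).
apply/eqP; apply: contraT; rewrite -unitfE -/(_ \in unitmx) => /mxrank_unit E.
have := mxrankM_maxl (P *m M) ((G + G^T) *m - (M^T *m Q)).
by rewrite E => /leq_trans/(_ (rank_leq_col _)); rewrite ltnn.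
Qed.

(** Induction for a possibly indefinite form: extend [B] by a non-isotropic vector of its orthogonal
    complement [K]. If [K] were totally isotropic, a nonzero [u] in [K] would be orthogonal to [K]
    and to the rows of [B], hence to everything, against nondegeneracy. *)
Lemma orthogonal_family r : (r <= d)%N ->
  exists B : 'M[R]_(r, d), exists2 c : 'rV[R]_r, B *m G *m B^T = diag_mx c &
    forall s, c 0 s != 0.
Proof.
elim: r => [|r IH] rd; first by exists 0, 0 => [|[]//]; apply/matrixP => -[].
have [B [c BE c0]] := IH (ltnW rd).
have cU : diag_mx c \in unitmx.
  by rewrite unitmxE det_diag unitfE; apply/prodf_neq0 => s _.
pose K := kermx (G *m B^T).
have [v vK v0] : exists2 v : 'rV[R]_d, (v <= K)%MS & (v *m G *m v^T) 0 0 != 0.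
  apply: contrapT => H.
  have iso (v : 'rV[R]_d) : (v <= K)%MS -> (v *m G *m v^T) 0 0 = 0.
    by move=> vK; apply/eqP; apply: contraT => v0; case: H; exists v.
  have iso2 (u v : 'rV[R]_d) : (u <= K)%MS -> (v <= K)%MS -> (u *m G *m v^T) 0 0 = 0.
    move=> uK vK; have := iso (u + v) (addmx_sub uK vK).
    rewrite linearD /= mulmxDr !mulmxDl !mxE.
    have := iso u uK; have := iso v vK; rewrite !mxE => -> ->.
    have -> : \sum_j (v *m G) 0 j * u^T j 0 = \sum_j (u *m G) 0 j * v^T j 0.
      have : (v *m G *m u^T) 0 0 = (u *m G *m v^T)^T 0 0.
        by rewrite !trmx_mul trmxK Gsym mulmxA.
      by rewrite !mxE.
    lra.
  have KK0 : K *m G *m K^T = 0.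
    apply/matrixP => i j.
    have -> : (K *m G *m K^T) i j = (row i K *m G *m (row j K)^T) 0 0.
      by rewrite -row_mul tr_row !mxE; apply: eq_bigr => z _; rewrite !mxE.
    by rewrite iso2 ?row_sub // mxE.
  have KB0 : K *m G *m B^T = 0 by rewrite -mulmxA mulmx_ker.
  have [u u0 uK] : exists2 u : 'rV[R]_d, u != 0 & (u <= K)%MS.
    have : K != 0 by rewrite kermx_eq0 /row_free neq_ltn (leq_ltn_trans (rank_leq_col _) rd).
    by case/rowV0Pn => u uK u0; exists u.
  have uB : u *m G *m B^T = 0 by rewrite -mulmxA; apply/sub_kermxP.
  have uKz : u *m G *m K^T = 0.
    by case/submxP: uK => D ->; rewrite -!(mulmxA D) KK0 mulmx0.
  (* Every x splits as x = (x G B^T diag(c)^-1) B + y with y in K. *)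
  have uG : u *m G *m 1%:M = 0.
    pose Z := G *m B^T *m invmx (diag_mx c) *m B.
    have YK : (1%:M - Z <= K)%MS.
      apply/sub_kermxP; rewrite mulmxBl mul1mx /Z -!mulmxA (mulmxA B) BE.
      by rewrite mulVmx // mulmx1 subrr.
    have -> : 1%:M = Z^T + (1%:M - Z)^T by rewrite -linearD /= addrC subrK trmx1.
    rewrite mulmxDr; have -> : u *m G *m Z^T = 0.
      rewrite /Z trmx_mul mulmxA uB mul0mx //.
    by case/submxP: YK => D ->; rewrite trmx_mul mulmxA uKz mul0mx addr0.
  by move: u0; rewrite mulmx1 in uG; rewrite -(mulmxK Gunit u) uG mul0mx eqxx.
exists (castmx (addn1 r, erefl) (col_mx B v)).
exists (castmx (erefl, addn1 r) (row_mx c (v *m G *m v^T))); last first.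
  move=> s; rewrite castmxE cast_ord_id /=; move: (cast_ord _ s) => {}s.
  rewrite -[s]splitK; case: (fintype.split s) => j /=; first by rewrite row_mxEl.
  by rewrite row_mxEr (ord1 j).
move: (addn1 r) => e; case: _ / e => /=; rewrite !castmx_id.
rewrite tr_col_mx mul_col_mx mul_col_row BE.
have vB : v *m G *m B^T = 0 by rewrite -mulmxA; apply/sub_kermxP.
have Bv : B *m G *m v^T = 0.
  by apply: trmx_inj; rewrite trmx0 !trmx_mul trmxK Gsym mulmxA vB.
rewrite vB Bv diag_mx_row; congr block_mx.
by apply/matrixP => i j; rewrite !ord1 !mxE eqxx mulr1n.
Qed.

End FormAlgebra.

(** * Generic configurations *)

Section Isometry.
Variables (R : realFieldType) (d k : nat) (G : 'M[R]_d).
Hypotheses (Gsym : G^T = G) (Gunit : G \in unitmx).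

(** The rows of [P *m M] form a basis made of combinations of differences of points, and [A] sends
    it to [P *m N]. By polarization equal distances give equal products of differences, so [A] is an
    isometry, and nondegeneracy forces it to carry every difference of [M] to that of [N]. The
    vector [b] then aligns one point. *)
Lemma isometry_of_dist_mx (M N : 'M[R]_(k, d)) (P : 'M[R]_(d, k)) :
  P *m const_mx 1 = 0 :> 'cV_d -> P *m M \in unitmx ->
  dist_mx G M = dist_mx G N ->
  exists A b, A *m G *m A^T = G /\ forall i, row i N = row i M *m A + b.
Proof.
move=> P1 PU DE.
have G2 : G + G^T = 2 *: G by rewrite Gsym scaler_nat mulr2n.
have polar m n (p : 'M[R]_(m, k)) (q : 'M[R]_(n, k)) :
    p *m const_mx 1 = 0 :> 'cV_m -> q *m const_mx 1 = 0 :> 'cV_n ->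
    p *m M *m G *m (q *m M)^T = p *m N *m G *m (q *m N)^T.
  move=> p1 q1; have q1T : const_mx 1 *m q^T = 0 :> 'rV_n.
    by rewrite -[const_mx 1]trmx_const -trmx_mul q1 trmx0.
  have := mul_dist_mx G M p1 q1T; rewrite DE mul_dist_mx // => /oppr_inj.
  rewrite G2 -!scalemxAr -!scalemxAl -!trmx_mul => /esym.
  by apply: scalerI; rewrite pnatr_eq0.
have [W WE] : exists W, P *m M = W by eexists.
rewrite WE in PU.
have WTU : W^T \in unitmx by rewrite unitmx_tr.
have [A PNA] : exists A, P *m N = W *m A.
  by exists (invmx W *m (P *m N)); rewrite mulKVmx.
have AGA : A *m G *m A^T = G.
  have := polar _ _ P P P1 P1; rewrite WE PNA (trmx_mul _ A) !mulmxA.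
  move=> /(can_inj (mulmxK WTU)); rewrite -!mulmxA.
  by move=> /(congr1 (mulmx (invmx W))); rewrite !(mulKmx PU) => /esym.
have AU : A \in unitmx.
  by move: Gunit; rewrite -AGA !unitmx_mul unitmx_tr => /andP[/andP[]].
have main (p : 'rV[R]_k) : p *m const_mx 1 = 0 :> 'M[R]_1 -> p *m N = p *m M *m A.
  move=> p1; have := polar _ _ p P p1 P1; rewrite WE PNA (trmx_mul _ A) !mulmxA.
  move=> /(can_inj (mulmxK WTU)); rewrite -[in LHS]AGA !mulmxA.
  have ATU : A^T \in unitmx by rewrite unitmx_tr.
  by move=> /(can_inj (mulmxK ATU)) /(can_inj (mulmxK Gunit)).
case: (posnP k) => [k0|k0].
  by exists A, 0; split => // i; have := leq_ltn_trans (leq0n i) (ltn_ord i); rewrite [X in (_ < X)%N]k0.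
pose i0 := Ordinal k0.
exists A, (row i0 N - row i0 M *m A); split => // i.
have e1 : (delta_mx 0 i - delta_mx 0 i0) *m const_mx 1 = 0 :> 'M[R]_1.
  by apply/matrixP => x y; rewrite mulmxBl -!rowE !mxE subrr.
have /eqP := main _ e1; rewrite !mulmxBl -!rowE subr_eq => /eqP->.
by rewrite addrAC addrA.
Qed.

End Isometry.

Section Generic.
Variables (R : realFieldType) (k d : nat).
Implicit Types (M : 'M[R]_(k, d)).

Definition mx_eval M (p : mpoly.mpoly (k * d) R) : R := mpoly.meval (fun j => mxvec M 0 j) p.

(** A proper Zariski-closed set lies in the zero set of one polynomial that is not identically zero,
    so a single [p] suffices as witness. *)
Definition generic (Pr : 'M[R]_(k, d) -> Prop) := exists p,
  (exists M, mx_eval M p != 0) /\ forall M, mx_eval M p != 0 -> Pr M.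

Lemma generic_imp (Pr Pr' : 'M[R]_(k, d) -> Prop) :
  (forall M, Pr M -> Pr' M) -> generic Pr -> generic Pr'.
Proof. by move=> H [p [p0 pH]]; exists p; split => // M /pH /H. Qed.

Lemma generic_true (Pr : 'M[R]_(k, d) -> Prop) : (forall M, Pr M) -> generic Pr.
Proof.
move=> H; exists 1; split => // ; exists 0.
by rewrite /mx_eval mpoly.meval1 oner_neq0.
Qed.

(* Two polynomials not vanishing at M1 resp. M2 restrict to nonzero
   univariate polynomials on the line through M1 and M2. *)
Lemma generic_and (Pr Pr' : 'M[R]_(k, d) -> Prop) :
  generic Pr -> generic Pr' -> generic (fun M => Pr M /\ Pr' M).
Proof.
move=> [p [[M1 p1] pH]] [q [[M2 q2] qH]]; exists (p * q); split; last first.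
  move=> M; rewrite /mx_eval mpoly.mevalM mulf_eq0 negb_or => /andP[/pH ? /qH ?].
  by split.
pose line (r : mpoly.mpoly (k * d) R) : {poly R} :=
  mpoly.mmap polyC (fun j => (mxvec M1 0 j)%:P + 'X * (mxvec (M2 - M1) 0 j)%:P) r.
have lineE r t : (line r).[t] = mx_eval (M1 + t *: (M2 - M1)) r.
  rewrite /line /mx_eval /mpoly.meval /mpoly.mmap horner_sum.
  apply: eq_bigr => m _; rewrite hornerM hornerC; congr (_ * _).
  rewrite /mpoly.mmap1 horner_prod; apply: eq_bigr => j _.
  have -> : mxvec (M1 + t *: (M2 - M1)) = mxvec M1 + t *: mxvec (M2 - M1).
    by rewrite linearD linearZ.
  by rewrite horner_exp !hornerE !mxE.
have l1 : line p != 0.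
  by apply: contraNneq p1 => E; have := lineE p 0; rewrite E horner0 scale0r addr0 => <-.
have l2 : line q != 0.
  apply: contraNneq q2 => E; have := lineE q 1.
  by rewrite E horner0 scale1r addrC subrK => <-.
have : line p * line q != 0 by rewrite mulf_neq0.
apply: contraNP => H; apply/eqP.
apply: (@poly_eq0_inf _ _ (fun m => m%:R)).
  by move=> m n /eqP; rewrite eqr_nat => /eqP.
move=> m; apply/rootP; rewrite hornerM !lineE.
apply/eqP; apply: contraT => E; case: H; exists (M1 + m%:R *: (M2 - M1)).
by rewrite /mx_eval mpoly.mevalM.
Qed.

Lemma generic_forall (I : finType) (Pr : I -> 'M[R]_(k, d) -> Prop) :
  (forall i, generic (Pr i)) -> generic (fun M => forall i, Pr i M).
Proof.
move=> H.
have : generic (fun M => forall i, i \in enum I -> Pr i M).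
  elim: (enum I) => [|i s IH]; first exact: generic_true.
  apply: generic_imp (generic_and (H i) IH) => M [Pi Ps] j.
  by rewrite inE => /predU1P[->|/Ps].
by apply: generic_imp => M HM i; apply: HM; rewrite mem_enum.
Qed.

(** The universal configuration: a polynomial construction carried out on it evaluates at [M] to the
    same construction on [M]. *)
Definition gen_mx : 'M[mpoly.mpoly (k * d) R]_(k, d) :=
  \matrix_(i, j) mpoly.mpolyX R (mpoly.mnm1 (mxvec_index i j)).

Lemma gen_mxE M : map_mx (mx_eval M) gen_mx = M.
Proof. by apply/matrixP => i j; rewrite !mxE /mx_eval mpoly.mevalXU mxvecE. Qed.

End Generic.

(* Injections of the unordered pairs, encoded on ordered pairs. *)
Definition edge_map k (f : 'I_k * 'I_k -> 'I_k * 'I_k) : Prop :=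
  [/\ forall i, (f (i, i)).1 = (f (i, i)).2,
      forall i j, i != j -> (f (i, j)).1 != (f (i, j)).2,
      forall i j, ends (f (i, j)) = ends (f (j, i)) &
      forall i j i' j', i != j -> i' != j' ->
        ends (f (i, j)) = ends (f (i', j')) -> ends (i, j) = ends (i', j')].

Definition vertex_induced k (f : 'I_k * 'I_k -> 'I_k * 'I_k) : Prop :=
  exists2 t : 'I_k -> 'I_k, injective t &
    forall i j, i != j -> ends (f (i, j)) = [set t i; t j]%SET.

Section GenericConfigurations.
Variables (R : realFieldType) (k d : nat) (G : 'M[R]_d).
Hypotheses (Gsym : G^T = G) (Gunit : G \in unitmx) (d0 : (0 < d)%N) (dk : (d + 2 <= k)%N).
Implicit Types (M : 'M[R]_(k, d)).

Let Gp : 'M[mpoly.mpoly (k * d) R]_d := map_mx (@mpoly.mpolyC (k * d) R) G.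

Lemma eval_constE m n (A : 'M[R]_(m, n)) M :
  map_mx (mx_eval M) (map_mx (@mpoly.mpolyC (k * d) R) A) = A.
Proof. by apply/matrixP => i j; rewrite !mxE /mx_eval mpoly.mevalC. Qed.

Lemma eval_dist_mx M : map_mx (mx_eval M) (dist_mx Gp (gen_mx R k d)) = dist_mx G M.
Proof.
have := map_dist_mx Gp (mpoly.meval (fun j => mxvec M 0 j)) (gen_mx R k d).
by rewrite -/(mx_eval M) => ->; rewrite eval_constE gen_mxE.
Qed.

Lemma generic_det_pull f m (P : 'M[R]_(m, k)) (Q : 'M[R]_(k, m)) M0 :
  \det (P *m pull_mx f (dist_mx G M0) *m Q) != 0 ->
  generic (fun M => \det (P *m pull_mx f (dist_mx G M) *m Q) != 0).
Proof.
move=> H; exists (\det (map_mx (@mpoly.mpolyC (k * d) R) P *m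
  pull_mx f (dist_mx Gp (gen_mx R k d)) *m map_mx (@mpoly.mpolyC (k * d) R) Q)).
have E M : mx_eval M (\det (map_mx (@mpoly.mpolyC (k * d) R) P *m
    pull_mx f (dist_mx Gp (gen_mx R k d)) *m map_mx (@mpoly.mpolyC (k * d) R) Q))
    = \det (P *m pull_mx f (dist_mx G M) *m Q).
  rewrite {1}/mx_eval -det_map_mx !map_mxM -/(mx_eval M) !eval_constE.
  congr (\det (_ *m _ *m _)); rewrite -(eval_dist_mx M).
  by apply/matrixP => i j; rewrite !mxE.
by split; [exists M0; rewrite E|move=> M; rewrite E].
Qed.

(** In an orthogonal basis the squared distance is a sum of one-dimensional squared distances, one
    per coordinate, with coefficients of either sign. *)
Lemma dist_mx_sum (B : 'M[R]_d) (c : 'rV[R]_d) (x : nat -> 'I_k -> R) :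
  B *m G *m B^T = diag_mx c ->
  dist_mx G ((\matrix_(i < k, s < d) x s i) *m B) =
    \sum_(s < d) c 0 s *: sqdist_mx (x s).
Proof.
move=> BE; apply/matrixP => i j; rewrite mxE summxE.
set X := \matrix_(i, s) _.
rewrite !row_mul -mulmxBl trmx_mul !mulmxA -(mulmxA _ B) -(mulmxA _ (B *m G)) BE.
rewrite mul_mx_diag !mxE; apply: eq_bigr => s _; rewrite !mxE; ring.
Qed.

(** If [f] is not induced by vertices, [edm_rank_one] and [edge_map_vertex] yield a configuration
    [M0] whose permuted distances violate the rank bound. The minor detecting this is a nonzero
    polynomial, so generic configurations violate the bound too. *)
Lemma generic_vertex_induced f : edge_map f ->
  generic (fun M => edm_rank_lt d.+1 (pull_mx f (dist_mx G M)) -> vertex_induced f).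
Proof.
move=> [f1 f2 f3 f4].
have [vf|nvf] := pselect (vertex_induced f); first exact: generic_true.
have [B [c BE c0]] := orthogonal_family Gsym Gunit (leqnn d).
pose cc s := if @insub nat _ 'I_d s is Some o then c 0 o else 1.
have ccE (s : 'I_d) : cc s = c 0 s by rewrite /cc valK.
have [M0 nM0] : exists M0, ~ edm_rank_lt d.+1 (pull_mx f (dist_mx G M0)).
  apply: contrapT => H; apply: nvf; apply: edge_map_vertex => //; first lia.
  move=> a; apply: (@edm_rank_one _ _ _ f1 f2 f3 f4 d cc) => //; first lia.
    by move=> s sd; rewrite -[s]/(val (Ordinal sd)) ccE.
  move=> x; under eq_bigr => s _ do rewrite ccE.
  rewrite -(dist_mx_sum x BE); apply: contrapT => H'; apply: H; by eexists; exact: H'.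
have [P [Q [P1 Q1 detN]]] : exists P Q, [/\ P *m const_mx 1 = 0 :> 'cV[R]_d.+1,
    const_mx 1 *m Q = 0 :> 'rV[R]_d.+1 & \det (P *m pull_mx f (dist_mx G M0) *m Q) != 0].
  apply: contrapT => H; apply: nM0 => P Q P1 Q1; apply/eqP; apply: contraT => detN.
  by case: H; exists P, Q.
apply: generic_imp (generic_det_pull detN) => M H /(_ P Q P1 Q1) E.
by rewrite E eqxx in H.
Qed.

(** The difference of the two distances is a polynomial. It is nonzero when point [l] sits at a
    non-isotropic [v] and all others at the origin, where [l] is an end of ij that is not an end of
    ab. *)
Lemma generic_dist_neq (i j a b : 'I_k) : i != j -> ends (i, j) != ends (a, b) ->
  generic (fun M => dist_mx G M i j != dist_mx G M a b).
Proof.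
move=> ij E.
exists (dist_mx Gp (gen_mx R k d) i j - dist_mx Gp (gen_mx R k d) a b).
have pE M : mx_eval M (dist_mx Gp (gen_mx R k d) i j - dist_mx Gp (gen_mx R k d) a b)
    = dist_mx G M i j - dist_mx G M a b.
  have DE x y : dist_mx G M x y = mx_eval M (dist_mx Gp (gen_mx R k d) x y).
    by rewrite -(eval_dist_mx M) [LHS]mxE.
  by rewrite !DE; exact: mpoly.mevalB.
split; last by move=> M; rewrite pE subr_eq0.
have [B [c BE c0]] := orthogonal_family Gsym Gunit (leqnn d).
pose v := row (Ordinal d0) B.
have vv : (v *m G *m v^T) 0 0 != 0.
  have -> : (v *m G *m v^T) 0 0 = (B *m G *m B^T) (Ordinal d0) (Ordinal d0).
    by rewrite -row_mul tr_row !mxE; apply: eq_bigr => z _; rewrite !mxE.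
  by rewrite BE mxE eqxx mulr1n.
suff [l [lij lab]] : exists l : 'I_k, (i == l) != (j == l) /\ (a == l) = (b == l).
  pose M := (\col_(m < k) (m == l)%:R : 'cV[R]_k) *m v.
  have DE m n : dist_mx G M m n = ((m == l)%:R - (n == l)%:R) ^+ 2 * (v *m G *m v^T) 0 0.
    have -> : dist_mx G M m n = ((row m M - row n M) *m G *m (row m M - row n M)^T) 0 0.
      by rewrite mxE.
    have -> : row m M - row n M = ((m == l)%:R - (n == l)%:R) *: v.
      by rewrite !row_mul -mulmxBl; apply/matrixP => x y; rewrite !mxE big_ord1 !mxE.
    by rewrite linearZ /= -scalemxAr -!scalemxAl scalerA mxE expr2.
  exists M; rewrite pE !DE lab subrr expr0n mul0r subr0 mulf_neq0 // expf_neq0 //.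
  by move: lij; case: (i == l); case: (j == l) => //= _;
    rewrite ?subr0 ?sub0r ?oppr_eq0 oner_neq0.
have [ia|ia] := boolP ((a == i) || (b == i)); last first.
  exists i; split; first by rewrite eqxx eq_sym [j == i]eq_sym (negbTE ij).
  by move: ia; rewrite negb_or => /andP[/negbTE-> /negbTE->].
have [ja|ja] := boolP ((a == j) || (b == j)); last first.
  exists j; split; first by rewrite eqxx (negbTE ij).
  by move: ja; rewrite negb_or => /andP[/negbTE-> /negbTE->].
move: E; rewrite ends_eqE // [i == a]eq_sym [j == b]eq_sym [i == b]eq_sym [j == a]eq_sym.
case/orP: ia => [/eqP ai|/eqP bi]; case/orP: ja => [/eqP aj|/eqP bj]; subst.
- by rewrite eqxx in ij.
- by rewrite !eqxx.
- by rewrite !eqxx orbT.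
- by rewrite eqxx in ij.
Qed.

(** [P] subtracts the first point from each of the next [d]. The determinant of [P *m M] is a
    polynomial with value 1 when these are the origin and the standard basis. *)
Lemma generic_spanning : generic (fun M => exists P : 'M[R]_(d, k),
  P *m const_mx 1 = 0 :> 'cV[R]_d /\ P *m M \in unitmx).
Proof using dk.
clear Gp Gsym Gunit d0.
have k0 : (0 < k)%N by lia.
have ks (s : 'I_d) : (s.+1 < k)%N by have := ltn_ord s; lia.
pose P : 'M[R]_(d, k) := \matrix_(s, i) ((i == Ordinal (ks s))%:R - (i == Ordinal k0)%:R).
have P1 : P *m const_mx 1 = 0 :> 'cV[R]_d.
  apply/matrixP => t b; rewrite !mxE; under eq_bigr => z _ do rewrite !mxE mulr1.
  rewrite sumrB (bigD1 (Ordinal (ks t))) //= eqxx big1 => [|z /negbTE->//].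
  by rewrite (bigD1 (Ordinal k0)) //= ?eqxx big1 ?subrr // => z /negbTE->.
exists (\det (map_mx (@mpoly.mpolyC (k * d) R) P *m gen_mx R k d)).
have E M : mx_eval M (\det (map_mx (@mpoly.mpolyC (k * d) R) P *m gen_mx R k d))
    = \det (P *m M).
  by rewrite {1}/mx_eval -det_map_mx !map_mxM -/(mx_eval M) eval_constE gen_mxE.
split; last by move=> M; rewrite E => H; exists P; rewrite unitmxE unitfE.
exists (\matrix_(i, s) (i == Ordinal (ks s))%:R); rewrite E.
rewrite (_ : P *m _ = 1%:M) ?det1 ?oner_neq0 //.
apply/matrixP => s t; rewrite !mxE.
rewrite (bigD1 (Ordinal (ks t))) //= big1 ?addr0 => [|i /negbTE it]; last first.
  by rewrite !mxE it mulr0.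
rewrite !mxE eqxx mulr1 -!(inj_eq val_inj) /= subr0 eqSS eq_sym.
by [].
Qed.

End GenericConfigurations.

(** * Matching the weighted distances of two mixtures *)

Section Matching.
Variables (R : realFieldType) (k : nat).
Implicit Types (D : 'M[R]_k) (w : 'I_k -> R).

(** Mass at [c] of the discrete measure with weight w_i w_j at each D_ij. The pairs are ordered, so
    an edge counts twice, and the diagonal is included. *)
Definition pair_mass w D (c : R) : R :=
  \sum_(p : 'I_k * 'I_k | D p.1 p.2 == c) w p.1 * w p.2.

Lemma pair_mass_edge w D (c : R) (i j : 'I_k) : i != j ->
  (forall p, (D p.1 p.2 == c) = (ends p == ends (i, j))) ->
  pair_mass w D c = 2 * (w i * w j).
Proof.
move=> ij H; rewrite /pair_mass (bigD1 (i, j)) /=; last by have /= -> := H (i, j).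
rewrite (bigD1 (j, i)) /=; last first.
  have /= -> := H (j, i); apply/andP; split; first by rewrite /ends /= finset.setUC.
  by rewrite xpair_eqE negb_and eq_sym ij.
rewrite big1 => [|[a b] /=]; first by ring.
have /= -> := H (a, b); rewrite eq_sym ends_eqE // !xpair_eqE => /andP[/andP[]].
rewrite [a == i]eq_sym [b == j]eq_sym [a == j]eq_sym [b == i]eq_sym.
by case/orP=> /andP[-> ->].
Qed.

Lemma pair_mass_gt0 w D (c : R) : (forall i, 0 < w i) ->
  pair_mass w D c != 0 <-> exists p, D p.1 p.2 = c.
Proof.
move=> w0; split=> [H|[p pc]].
  apply: contrapT => N; move: H; rewrite /pair_mass big1 ?eqxx // => p /eqP pc.
  by case: N; exists p.
rewrite gt_eqF // /pair_mass (bigD1 p) /= ?pc // ltr_pwDl ?mulr_gt0 //.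
by apply: sumr_ge0 => q _; rewrite ltW // mulr_gt0.
Qed.

Variables (D D' : 'M[R]_k).
Hypotheses (D_diag : forall i, D i i = 0) (D'_diag : forall i, D' i i = 0).
Hypotheses (D_sym : forall i j, D i j = D j i) (D'_sym : forall i j, D' i j = D' j i).
Hypothesis D_gen : forall i j a b, i != j -> ends (i, j) != ends (a, b) -> D i j != D a b.

Lemma D_ends p q : ends p = ends q -> D p.1 p.2 = D q.1 q.2.
Proof.
case: p q => [i j] [a b] /= E; have [ij|ij] := eqVneq i j.
  have : a \in ends (i, j) by rewrite E !inE eqxx.
  have : b \in ends (i, j) by rewrite E !inE eqxx orbT.
  by rewrite /ends /= !inE -ij !orbb => /eqP-> /eqP->; rewrite !D_diag.
have /eqP := E; rewrite ends_eqE // => /orP[/andP[/eqP-> /eqP->]|/andP[/eqP-> /eqP->]] //.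
Qed.

(* The values of D off the diagonal are pairwise distinct, and all of them are
   values of D' off the diagonal, so by counting D' cannot repeat a value. *)
Lemma edge_matching :
  (forall c, (exists p, D p.1 p.2 = c) <-> (exists p, D' p.1 p.2 = c)) ->
  exists f : {ffun 'I_k * 'I_k -> 'I_k * 'I_k}, edge_map f /\ D' = pull_mx f D.
Proof.
move=> H.
have D_eq0 i j : (D i j == 0) = (i == j).
  apply/eqP/eqP => [E|->//]; apply/eqP; apply: contraT => ij.
  have : ends (i, j) != ends (i, i).
    by rewrite ends_eqE // eqxx /= orbb eq_sym.
  by move/(D_gen ij); rewrite D_diag E eqxx.
have ex p : exists q, D q.1 q.2 = D' p.1 p.2 by apply/H; exists p.
have [f fE] := choice ex.
have ff : D' = pull_mx [ffun p => f p] D.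
  by apply/matrixP => i j; rewrite mxE ffunE fE.
have D_inj i j a b : i != j -> D i j = D a b -> ends (i, j) = ends (a, b).
  by move=> ij DE; apply/eqP; apply: contraT => /(D_gen ij); rewrite DE eqxx.
have D'_ends p i j : i != j -> ends p = ends (i, j) -> D' p.1 p.2 = D' i j.
  case: p => a b /= ij /esym/eqP; rewrite ends_eqE //.
  by case/orP => /andP[/eqP-> /eqP->] //.
pose E := [set e : {set 'I_k} | #|e| == 2%N]%SET.
(* [g] is the map induced on two-element sets, read off from [f] at some ordered representative; the
   empty set is the default for sets that are not of the form [ends p]. *)
pose g (e : {set 'I_k}) := if [pick p | ends p == e] is Some p then ends (f p) else finset.set0.
have endsE i j : i != j -> ends (i, j) \in E by move=> ij; rewrite inE cards2 ij.
have gE i j : i != j -> exists2 p, ends p = ends (i, j) & g (ends (i, j)) = ends (f p).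
  move=> ij; rewrite /g; case: pickP => [p /eqP pE|/(_ (i, j))]; last by rewrite eqxx.
  by exists p.
have Esub : E \subset g @: E.
  apply/fintype.subsetP => e; rewrite inE => /cards2P[a [b [ab ->]]].
  have /H[[i j] /= ijE] : exists p, D p.1 p.2 = D a b by exists (a, b).
  have ij : i != j.
    by apply: contra_neq ab => ij; apply/eqP; rewrite -D_eq0 -ijE ij D'_diag.
  apply/imsetP; exists (ends (i, j)); first exact: endsE.
  have [p pE ->] := gE i j ij; apply: (@D_inj a b) => //.
  by rewrite fE (D'_ends p _ _ ij pE).
have cardE : #|g @: E| = #|E|.
  by apply/eqP; rewrite eqn_leq leq_imset_card subset_leq_card.
have gEE : g @: E = E by apply/esym/eqP; rewrite eqEcard Esub cardE leqnn.
have ginj : {in E &, injective g} by apply/imset_injP/eqP.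
have ndiag i j : i != j -> (f (i, j)).1 != (f (i, j)).2.
  move=> ij; have [p pE gp] := gE i j ij.
  have : g (ends (i, j)) \in E by rewrite -gEE imset_f ?endsE.
  have -> : ((f (i, j)).1 != (f (i, j)).2) = ((f p).1 != (f p).2).
    by rewrite -!D_eq0 !fE (D'_ends p _ _ ij pE).
  by rewrite gp inE cards2; case: ((f p).1 == (f p).2).
have gfE i j : i != j -> g (ends (i, j)) = ends (f (i, j)).
  move=> ij; have [p pE ->] := gE i j ij; apply/esym.
  rewrite [f (i, j)]surjective_pairing [f p]surjective_pairing.
  by apply: D_inj; [exact: ndiag|rewrite !fE (D'_ends p _ _ ij pE)].
exists [ffun p => f p]; split => //; split.
- by move=> i; rewrite ffunE; apply/eqP; rewrite -D_eq0 fE D'_diag.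
- by move=> i j ij; rewrite ffunE; exact: ndiag.
- move=> i j; rewrite !ffunE; have [->//|ij] := eqVneq i j.
  rewrite -!gfE // 1?eq_sym //; congr g; exact: finset.setUC.
- move=> i j i' j' ij ij'; rewrite !ffunE -!gfE // => /ginj; apply; exact: endsE.
Qed.

End Matching.

Section Reconstruct.
Variables (R : realFieldType) (k d : nat) (G : 'M[R]_d).
Hypotheses (Gsym : G^T = G) (Gunit : G \in unitmx) (d0 : (0 < d)%N) (dk : (d + 2 <= k)%N).

Lemma dist_mx_diag (M : 'M[R]_(k, d)) i : dist_mx G M i i = 0.
Proof. by rewrite mxE subrr mul0mx mul0mx mxE. Qed.

Lemma dist_mx_sym (M : 'M[R]_(k, d)) i j : dist_mx G M i j = dist_mx G M j i.
Proof.
by rewrite mxE [RHS]mxE -[row i M - row j M]opprB linearN /= !mulNmx mulmxN opprK.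
Qed.

(** Three generic conditions are combined: distinct distances make the two configurations match by
    an edge map, the rank bound makes it come from a vertex map [t], and affine spanning turns equal
    distances into an isometry. *)
Lemma generic_reconstruct : generic (fun M : 'M[R]_(k, d) =>
  forall (w wb : 'I_k -> R) (N : 'M[R]_(k, d)),
    (forall i, 0 < w i) -> (forall i, 0 < wb i) ->
    (forall c, pair_mass w (dist_mx G M) c = pair_mass wb (dist_mx G N) c) ->
    exists (t : 'I_k -> 'I_k) (A : 'M[R]_d) (b : 'rV[R]_d),
      [/\ injective t, A *m G *m A^T = G, forall i, wb i = w (t i) &
          forall i, row i N = row (t i) M *m A + b]).
Proof.
have g1 : generic (fun M : 'M[R]_(k, d) => forall q : ('I_k * 'I_k) * ('I_k * 'I_k),
    q.1.1 != q.1.2 -> ends q.1 != ends q.2 ->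
    dist_mx G M q.1.1 q.1.2 != dist_mx G M q.2.1 q.2.2).
  apply: generic_forall => -[[i j] [a b]] /=.
  have [/andP[ij E]|nE] := boolP ((i != j) && (ends (i, j) != ends (a, b))).
    by apply: generic_imp (generic_dist_neq Gsym Gunit d0 ij E).
  by apply: generic_true => M ij E; rewrite ij E in nE.
have g2 : generic (fun M : 'M[R]_(k, d) => forall f : {ffun 'I_k * 'I_k -> 'I_k * 'I_k},
    edge_map f -> edm_rank_lt d.+1 (pull_mx f (dist_mx G M)) -> vertex_induced f).
  apply: generic_forall => f.
  have [ef|nf] := pselect (edge_map f); last exact: generic_true.
  by apply: generic_imp (generic_vertex_induced Gsym Gunit d0 dk ef).
have g3 := @generic_spanning R k d dk.
apply: generic_imp (generic_and (generic_and g1 g2) g3).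
move=> M [[H1 H2] [P [P1 PU]]] w wb N w0 wb0 mass.
set D := dist_mx G M in H1 H2 mass; set D' := dist_mx G N in mass.
have D_gen i j a b : i != j -> ends (i, j) != ends (a, b) -> D i j != D a b.
  exact: (H1 ((i, j), (a, b))).
have Dd := dist_mx_diag M; have Dd' := dist_mx_diag N.
have Ds := dist_mx_sym M; have Ds' := dist_mx_sym N.
have [f [ef D'E]] : exists f : {ffun 'I_k * 'I_k -> 'I_k * 'I_k},
    edge_map f /\ D' = pull_mx f D.
  apply: edge_matching => // c.
  by rewrite -(pair_mass_gt0 D c w0) -(pair_mass_gt0 D' c wb0) mass.
have [t tinj tE] : vertex_induced f by apply: H2 ef _; rewrite -D'E; exact: dist_mx_rank.
have D't i j : D' i j = D (t i) (t j).
  have [->|ij] := eqVneq i j; first by rewrite /D /D' Dd Dd'.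
  by rewrite D'E mxE (@D_ends _ _ _ Dd Ds _ (t i, t j)) // tE.
have D_ends_iff p i j : i != j -> (D p.1 p.2 == D i j) = (ends p == ends (i, j)).
  move=> ij; apply/eqP/eqP => [E|E]; last by rewrite (@D_ends _ _ _ Dd Ds _ _ E).
  case: p E => a b /= E; apply/esym/eqP; apply: contraT => /(D_gen _ _ _ _ ij).
  by rewrite E eqxx.
have ttE i j : i != j -> t i != t j by move=> ij; rewrite (inj_eq tinj).
have massE i j : i != j -> wb i * wb j = w (t i) * w (t j).
  move=> ij; apply: (@mulfI _ 2); first by rewrite pnatr_eq0.
  rewrite -(@pair_mass_edge _ _ w D (D (t i) (t j)) _ _ (ttE _ _ ij)); last first.
    by move=> p; rewrite D_ends_iff // ttE.
  rewrite mass (@pair_mass_edge _ _ wb D' _ _ _ ij) // => -[a b] /=.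
  rewrite D't (D_ends_iff (t a, t b)) ?ttE // eq_sym [RHS]eq_sym !ends_eqE ?ttE //.
  by rewrite !(inj_eq tinj).
(* Since k >= 3 there are two further indices, and w_i^2 = (w_i w_j)(w_i w_l) / (w_j w_l) is
   determined by the masses of edges; positivity selects the root. *)
have wE i : wb i = w (t i).
  have [j [l [ij il jl]]] : exists j l : 'I_k, [/\ i != j, i != l & j != l].
    have k3 : (2 < k)%N by lia.
    have k0 : (0 < k)%N by lia. have k1 : (1 < k)%N by lia.
    have [i0|i0] := eqVneq (val i) 0%N; [|have [i1|i1] := eqVneq (val i) 1%N].
    - by exists (Ordinal k1), (Ordinal k3); rewrite -!(inj_eq val_inj) /= i0.
    - by exists (Ordinal k0), (Ordinal k3); rewrite -!(inj_eq val_inj) /= i1.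
    - by exists (Ordinal k0), (Ordinal k1); rewrite -!(inj_eq val_inj) /=.
  have := massE i j ij; have := massE i l il; have := massE j l jl.
  have := wb0 i; have := wb0 j; have := wb0 l.
  have := w0 (t i); have := w0 (t j); have := w0 (t l).
  move: (wb i) (wb j) (wb l) (w (t i)) (w (t j)) (w (t l)) => x y z x' y' z'.
  move=> z'0 y'0 x'0 z0 y0 x0 yz xz xy.
  have : x ^+ 2 = x' ^+ 2.
    apply: (@mulIf _ (y * z)); first by rewrite mulf_neq0 // gt_eqF.
    by rewrite {2}yz; transitivity ((x * y) * (x * z)); [ring|rewrite xz xy; ring].
  by move/eqP; rewrite eqrXn2 ?ltW // => /eqP.
have [s sK Ks] : bijective t := injF_bij tinj.
have DN : dist_mx G M = dist_mx G (rowsub s N).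
  apply/matrixP => i j; rewrite -[RHS]/_; transitivity (D' (s i) (s j)).
    by rewrite D't !Ks.
  by rewrite !mxE !row_rowsub.
have [A [b [AGA Ab]]] := isometry_of_dist_mx Gsym Gunit P1 PU DN.
exists t, A, b; split => // i.
by rewrite -Ab row_rowsub sK.
Qed.

End Reconstruct.

Import numFieldNormedType.Exports.
Local Open Scope classical_set_scope.
Local Open Scope ring_scope.

(** * Integration over R^n *)

Section LebesgueShift.
Variable R : realType.
Local Notation lam := (@lebesgue_measure R).

Lemma lebesgue_measure_shift (a : R) (A : set (measurableTypeR R)) :
  measurable A -> lam ((fun t => t + a) @^-1` A) = lam A.
Proof.
have ms : measurable_fun [set: measurableTypeR R] (fun t : measurableTypeR R => t + a : measurableTypeR R).
  by exact: measurable_funD.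
move=> mA; rewrite -[LHS]/(pushforward lam (fun t : measurableTypeR R => t + a : measurableTypeR R) A).
pose ms' := isMeasurableFun.Build _ _ _ _ _ ms.
pose phi : {mfun _ >-> _} := HB.pack (fun t : measurableTypeR R => t + a : measurableTypeR R) ms'.
apply/esym; rewrite (@lebesgue_measure_unique R (pushforward lam phi)) //.
move=> _ [[x y] /= _ <-]; rewrite /pushforward /=.
have -> : phi @^-1` `]x, y] = `]x - a, y - a]%classic.
  by apply/seteqP; split => t /=; rewrite !in_itv /= ltrBlDr lerBrDr.
rewrite !lebesgue_measure_itv /= !lte_fin ltrD2r.
by case: ifP => // _; rewrite -!EFinB; congr EFin; ring.
Qed.

Lemma ge0_integral_shift (a : R) (f : R -> \bar R) :
  measurable_fun [set: R] f -> (forall t, 0 <= f t)%E ->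
  (\int[lam]_(t in [set: R]) f (t + a)%R = \int[lam]_(t in [set: R]) f t)%E.
Proof.
move=> mf f0.
have ms : measurable_fun [set: measurableTypeR R] (fun t : measurableTypeR R => t + a : measurableTypeR R).
  by exact: measurable_funD.
have := @ge0_integral_pushforward _ _ _ _ R _ ms lam setT f measurableT mf (fun y _ => f0 y).
rewrite preimage_setT /= => <-.
pose ms' := isMeasurableFun.Build _ _ _ _ _ ms.
pose phi : {mfun _ >-> _} := HB.pack (fun t : measurableTypeR R => t + a : measurableTypeR R) ms'.
apply: (@eq_measure_integral _ _ _ _ lam (pushforward lam phi)) => A mA _.
exact: lebesgue_measure_shift.
Qed.

End LebesgueShift.

Section SigmaFiniteProduct.
Local Open Scope ereal_scope.
Context d1 d2 (T1 : measurableType d1) (T2 : measurableType d2) (R : realType).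
Variables (m1 : {sigma_finite_measure set T1 -> \bar R})
  (m2 : {sigma_finite_measure set T2 -> \bar R}).

(* In the library the sigma-finite structure of [m1 \x m2] is shadowed by the
   one for probability measures; hence this copy of the product measure. *)
Definition sf_prod : set (T1 * T2)%type -> \bar R := m1 \x m2.

HB.instance Definition _ := Measure.on sf_prod.

Lemma sf_prod_sigma_finite : sigma_finite setT sf_prod.
Proof.
have [F FT mF] := sigma_finiteT m1; have [G GT mG] := sigma_finiteT m2.
pose q (n : nat) : nat * nat := odflt (0%N, 0%N) (unpickle n).
exists (fun n => F (q n).1 `*` G (q n).2).
  apply/esym/seteqP; split => // -[x y] _.
  have [i _ Fx] : (\bigcup_i F i) x by rewrite -FT.
  have [j _ Gy] : (\bigcup_i G i) y by rewrite -GT.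
  by exists (pickle (i, j)) => //; rewrite /q pickleK.
move=> n; have [? ?] := mF (q n).1; have [? ?] := mG (q n).2.
split; first exact: measurableX.
by rewrite /sf_prod product_measure1E // lte_mul_pinfty // ge0_fin_numE.
Qed.

HB.instance Definition _ := Measure_isSigmaFinite.Build _ _ _ sf_prod sf_prod_sigma_finite.

End SigmaFiniteProduct.

Section Model.
Variable R : realType.
Local Notation lam := (@lebesgue_measure R).
Local Open Scope ereal_scope.

(* [iint] is defined by iterated integrals over row vectors; a model presents it as
   the integral over an honest (product) measure space, so that Tonelli applies. *)
Record leb_model (n : nat) := LebModel {
  lm_disp : measure_display;
  lm_T : measurableType lm_disp;
  lm_mu : {sigma_finite_measure set lm_T -> \bar R};
  lm_vec : lm_T -> 'rV[R]_n;
  lm_pt : 'rV[R]_n -> lm_T;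
  lm_ptK : cancel lm_pt lm_vec;
  lm_mvec : forall i, measurable_fun [set: lm_T] (fun x => lm_vec x 0%R i);
  lm_mpt : forall d (Z : measurableType d) (g : Z -> 'rV[R]_n),
    (forall i, measurable_fun [set: Z] (fun z => g z 0%R i)) ->
    measurable_fun [set: Z] (fun z => lm_pt (g z));
  lm_iint : forall f : 'rV[R]_n -> \bar R, (forall x, 0 <= f x) ->
    measurable_fun [set: lm_T] (fun x => f (lm_vec x)) ->
    iint f = \int[lm_mu]_(x in [set: lm_T]) f (lm_vec x);
  lm_shift : forall (m : 'rV[R]_n) (f : 'rV[R]_n -> \bar R), (forall x, 0 <= f x) ->
    measurable_fun [set: lm_T] (fun x => f (lm_vec x)) ->
    \int[lm_mu]_(x in [set: lm_T]) f (lm_vec x + m)%R =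
      \int[lm_mu]_(x in [set: lm_T]) f (lm_vec x) }.

Definition leb_model0 : leb_model 0.
Proof.
refine (@LebModel 0 _ unit (@dirac _ unit tt R) (fun=> 0%R) (fun=> tt) _ _ _ _ _).
- by move=> x; apply/matrixP => i [].
- by move=> [].
- by move=> d Z g _; exact: measurable_cst.
- move=> f f0 mf.
  rewrite [RHS](@integral_dirac _ unit tt R setT measurableT (fun=> f 0%R)) //.
  by rewrite diracT mul1e.
- move=> m f f0 mf; apply: eq_integral => x _; congr f.
  by apply/matrixP => i [].
Defined.

Section Step.
Variables (n : nat) (L : leb_model n).
Local Notation T := (lm_T L).
Local Notation mu := (lm_mu L).

Let vec (z : measurableTypeR R * T) : 'rV[R]_(1 + n) := row_mx (const_mx z.1) (lm_vec z.2).
Let pt (v : 'rV[R]_(1 + n)) : measurableTypeR R * T := (v 0%R 0%R, lm_pt L (rsubmx v)).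

Lemma step_ptK : cancel pt vec.
Proof.
move=> v; rewrite /vec /= lm_ptK -[RHS]hsubmxK; congr row_mx.
apply/matrixP => i j; rewrite !ord1 !mxE; congr (v _ _); exact/val_inj.
Qed.

Lemma step_mvec i : measurable_fun setT (fun z => vec z 0%R i).
Proof.
rewrite -[i]splitK; case: (fintype.split i) => j.
  rewrite [X in measurable_fun _ X](_ : _ = fst); first exact: measurable_fst.
  by apply/funext => z; rewrite /vec row_mxEl mxE.
rewrite [X in measurable_fun _ X](_ : _ = (fun x => lm_vec x 0%R j) \o snd).
  exact: (measurableT_comp (lm_mvec j) measurable_snd).
by apply/funext => z; rewrite /vec row_mxEr.
Qed.

Lemma step_mpt d (Z : measurableType d) (g : Z -> 'rV[R]_(1 + n)) :
    (forall i, measurable_fun [set: Z] (fun z => g z 0%R i)) ->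
    measurable_fun [set: Z] (fun z => pt (g z)).
Proof.
move=> mg; apply: measurable_fun_pair; first exact: (mg 0%R).
apply: (lm_mpt (g := fun z => rsubmx (g z))) => i.
rewrite [X in measurable_fun _ X](_ : _ = fun z => g z 0%R (rshift 1 i)); first exact: mg.
by apply/funext => z; rewrite mxE.
Qed.

Lemma step_slice (f : 'rV[R]_(1 + n) -> \bar R) (t : R) :
  measurable_fun setT (fun z => f (vec z)) ->
  measurable_fun setT (fun x : T => f (row_mx (const_mx t : 'rV[R]_1) (lm_vec x))).
Proof.
by move=> mf; exact: (measurableT_comp mf (measurable_pair1 (t : measurableTypeR R))).
Qed.

Lemma step_fubini (f : 'rV[R]_(1 + n) -> \bar R) : (forall x, 0 <= f x) ->
  measurable_fun setT (fun z => f (vec z)) ->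
  \int[lam \x mu]_(z in setT) f (vec z) =
  \int[lam]_(t in [set: R]) \int[mu]_(x in [set: T]) f (row_mx (const_mx t : 'rV[R]_1) (lm_vec x)).
Proof. by move=> f0 mf; rewrite fubini_tonelli1. Qed.

Lemma step_iint (f : 'rV[R]_(1 + n) -> \bar R) : (forall x, 0 <= f x) ->
  measurable_fun setT (fun z => f (vec z)) ->
  @iint R n.+1 f = \int[lam \x mu]_(z in setT) f (vec z).
Proof.
move=> f0 mf; rewrite step_fubini //=; apply: eq_integral => t _.
by rewrite (lm_iint (l := L)) //; exact: step_slice.
Qed.

(** By Tonelli, [ge0_integral_shift] translates the first coordinate, and the translation invariance
    of the model [L] the others. *)
Lemma step_shift (m : 'rV[R]_(1 + n)) (f : 'rV[R]_(1 + n) -> \bar R) : (forall x, 0 <= f x) ->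
  measurable_fun setT (fun z => f (vec z)) ->
  \int[lam \x mu]_(z in setT) f (vec z + m)%R = \int[lam \x mu]_(z in setT) f (vec z).
Proof.
move=> f0 mf.
have mfm : measurable_fun setT (fun z => f (vec z + m)%R).
  have -> : (fun z => f (vec z + m)%R) = (fun z => f (vec (pt (vec z + m)%R))).
    by apply/funext => z; rewrite step_ptK.
  apply: (measurableT_comp mf); apply: step_mpt => i.
  rewrite [X in measurable_fun _ X](_ : _ = fun z => (vec z 0%R i + m 0%R i)%R).
    by apply: measurable_funD => //; exact: step_mvec.
  by apply/funext => z; rewrite mxE.
rewrite (@step_fubini (fun x => f (x + m)%R)) // step_fubini //.
pose h (t : R) := \int[mu]_(x in [set: T]) f (row_mx (const_mx t : 'rV[R]_1) (lm_vec x)).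
have mh : measurable_fun setT h.
  by apply: (@measurable_fun_fubini_tonelli_F _ _ _ _ R mu (fun z => f (vec z))).
have h0 t : 0 <= h t by apply: integral_ge0 => x _; exact: f0.
rewrite -[RHS]/(\int[lam]_(t in [set: R]) h t) -(ge0_integral_shift (m 0%R 0%R) mh h0).
apply: eq_integral => t _; rewrite /h.
have := @lm_shift _ L (rsubmx m) (fun v => f (row_mx (const_mx (t + m 0%R 0%R)%R : 'rV[R]_1) v)).
move=> <- //; last exact: step_slice.
apply: eq_integral => x _; congr f.
rewrite -[m in LHS]hsubmxK add_row_mx; congr row_mx.
apply/matrixP => i j; rewrite !ord1 !mxE; congr (_ + m _ _)%R; exact/val_inj.
Qed.

Definition leb_modelS : leb_model n.+1 :=
  @LebModel n.+1 _ _ (sf_prod lam mu) vec pt step_ptK step_mvec step_mpt step_iint step_shift.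

End Step.

Fixpoint lebesgue_model n : leb_model n :=
  if n is n'.+1 then leb_modelS (lebesgue_model n') else leb_model0.

End Model.

(** * From the law of a function to integrals of its functions *)

Section LawTransfer.
Local Open Scope ereal_scope.
Context d (Z : measurableType d) (R : realType).
Variables (nu : {measure set Z -> \bar R}) (D : Z -> R).
Hypothesis mD : measurable_fun setT D.

Import HBNNSimple.

Lemma integral_law_nnsfun (F : Z -> R) (g : {nnsfun R >-> R}) :
  measurable_fun setT F -> (forall z, 0 <= F z)%R ->
  \int[nu]_(z in setT) (F z * g (D z))%:E =
  \sum_(r \in range g) r%:E * \int[nu]_(z in setT) (F z * \1_(g @^-1` [set r]) (D z))%:E.
Proof.
move=> mF F0.
have mI r : measurable_fun setT (fun z => F z * \1_(g @^-1` [set r]) (D z))%R.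
  apply: measurable_funM => //; apply: measurableT_comp mD.
  by apply: measurable_indic; exact: measurable_sfunP.
transitivity (\int[nu]_(z in setT) (\sum_(r \in range g)
    (r * (F z * \1_(g @^-1` [set r]) (D z)))%:E)).
  apply: eq_integral => z _; rewrite fsumEFin // fimfunE; congr EFin.
  rewrite !fsbig_finite //= mulr_sumr; apply: eq_bigr => r _; ring.
rewrite ge0_integral_fsum //.
- apply: eq_fsbigr => r rg; rewrite -ge0_integralZl //.
  + by apply/measurable_EFinP.
  + by move=> z _; rewrite lee_fin mulr_ge0 // indicE.
  + by rewrite lee_fin; move: rg => /[!inE] -[x _ <-].
- by move=> r; apply/measurable_EFinP; apply: measurable_funM.
- move=> r z _; rewrite lee_fin.
  have [/= [x _ <-]|nr] := pselect (range g r); first by rewrite !mulr_ge0 // indicE.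
  rewrite indicE memNset ?mulr0 //= => E; apply: nr.
  by exists (D z).
Qed.

Lemma integral_law_lim (F : Z -> R) (h : R -> R) (mh : measurable_fun setT (EFin \o h)) :
  measurable_fun setT F -> (forall z, 0 <= F z)%R -> (forall x, 0 <= h x)%R ->
  \int[nu]_(z in setT) (F z * h (D z))%:E =
  limn (fun n => \int[nu]_(z in setT) (F z * nnsfun_approx measurableT mh n (D z))%:E).
Proof.
move=> mF F0 h0; rewrite -monotone_convergence //.
- apply: eq_integral => z _; apply/esym/cvg_lim => //.
  under eq_fun do rewrite EFinM.
  rewrite EFinM; apply: cvgeZl => //.
  by apply: (cvg_nnsfun_approx measurableT mh) => // x _; rewrite lee_fin.
- move=> n; apply/measurable_EFinP; apply: measurable_funM => //.
  by apply: measurableT_comp mD; exact: measurable_funP.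
- by move=> n z _; rewrite lee_fin mulr_ge0.
- move=> z _ m n mn; rewrite lee_fin ler_wpM2l //.
  exact/lefP/nd_nnsfun_approx.
Qed.

(** The hypothesis covers indicators; [integral_law_nnsfun] extends it to simple functions, and
    [integral_law_lim] to nonnegative [h] by monotone convergence. Applied to h(s) = exp(- t s),
    this yields equal Laplace transforms. *)
Lemma integral_law_eq (F F' : Z -> R) (h : R -> R) :
  measurable_fun setT F -> (forall z, 0 <= F z)%R ->
  measurable_fun setT F' -> (forall z, 0 <= F' z)%R ->
  measurable_fun setT h -> (forall x, 0 <= h x)%R ->
  (forall B, measurable B -> \int[nu]_(z in setT) (F z * \1_B (D z))%:E =
     \int[nu]_(z in setT) (F' z * \1_B (D z))%:E) ->
  \int[nu]_(z in setT) (F z * h (D z))%:E = \int[nu]_(z in setT) (F' z * h (D z))%:E.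
Proof.
move=> mF F0 mF' F'0 mh h0 H.
have mh' : measurable_fun setT (EFin \o h) by exact/measurable_EFinP.
rewrite (integral_law_lim mh') // (integral_law_lim mh' mF') //; congr (limn _).
apply/funext => n; rewrite !integral_law_nnsfun //.
by apply: eq_fsbigr => r _; rewrite H.
Qed.

End LawTransfer.

Section Measurability.
Variables (R : realType) (d : nat) (G : 'M[R]_d).

Lemma measurable_bil d' (Z : measurableType d') (g h : Z -> 'rV[R]_d) :
  (forall i, measurable_fun setT (fun z => g z 0 i)) ->
  (forall i, measurable_fun setT (fun z => h z 0 i)) ->
  measurable_fun setT (fun z => bil G (g z) (h z)).
Proof.
move=> mg mh.
rewrite [X in measurable_fun _ X](_ : _ =
    fun z => \sum_j (\sum_i g z 0 i * G i j) * h z 0 j); last first.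
  apply/funext => z; rewrite /bil mxE; apply: eq_bigr => j _.
  by rewrite !mxE.
apply: measurable_sum => j; apply: measurable_funM => //.
by apply: measurable_sum => i; apply: measurable_funM.
Qed.

Lemma iint_ge0 n (f : 'rV[R]_n -> \bar R) : (forall x, 0 <= f x)%E -> (0 <= iint f)%E.
Proof.
elim: n f => [|n IH] f f0 /=; first exact: f0.
by apply: integral_ge0 => t _; apply: IH => v; exact: f0.
Qed.

End Measurability.

Section Iint2.
Variables (R : realType) (d : nat).
Local Open Scope ereal_scope.
Let L := lebesgue_model R d.
Let T := lm_T L.
Let mu := lm_mu L.

Lemma iint2 (F : 'rV[R]_d -> 'rV[R]_d -> \bar R) : (forall x y, 0 <= F x y) ->
  measurable_fun setT (fun z : T * T => F (lm_vec z.1) (lm_vec z.2)) ->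
  iint (fun x => iint (F x)) =
    \int[mu]_(x in [set: T]) \int[mu]_(y in [set: T]) F (lm_vec x) (lm_vec y).
Proof.
move=> F0 mF.
have inner x : iint (F x) = \int[mu]_(y in [set: T]) F x (lm_vec y).
  rewrite (lm_iint (l := L)) // -(lm_ptK L x).
  exact: (measurableT_comp mF (measurable_pair1 (lm_pt L x))).
rewrite (lm_iint (l := L)).
- by apply: eq_integral => x _; rewrite inner.
- by move=> x; exact: iint_ge0.
- rewrite [X in measurable_fun _ X](_ : _ =
    fun x : T => \int[mu]_(y in [set: T]) F (lm_vec x) (lm_vec y)).
    exact: (@measurable_fun_fubini_tonelli_F _ _ _ _ R mu (fun z => F (lm_vec z.1) (lm_vec z.2))).
  by apply/funext => x; rewrite inner.
Qed.

End Iint2.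

Section BilTheory.
Variables (R : realType) (d : nat) (G : 'M[R]_d).

Lemma bilDl u v x : bil G (u + v) x = bil G u x + bil G v x.
Proof. by rewrite /bil !mulmxDl mxE. Qed.
Lemma bilDr u v x : bil G x (u + v) = bil G x u + bil G x v.
Proof. by rewrite /bil linearD mulmxDr mxE. Qed.
Lemma bilZl a u x : bil G (a *: u) x = a * bil G u x.
Proof. by rewrite /bil -!scalemxAl mxE. Qed.
Lemma bilZr a u x : bil G x (a *: u) = a * bil G x u.
Proof. by rewrite /bil linearZ /= -scalemxAr mxE. Qed.
Lemma bilNl u x : bil G (- u) x = - bil G u x.
Proof. by rewrite -scaleN1r bilZl mulN1r. Qed.
Lemma bilNr u x : bil G x (- u) = - bil G x u.
Proof. by rewrite -scaleN1r bilZr mulN1r. Qed.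
Lemma bilC u v : G^T = G -> bil G u v = bil G v u.
Proof.
move=> Gs; rewrite /bil; transitivity ((u *m G *m v^T)^T 0 0); first by rewrite [RHS]mxE.
by rewrite !trmx_mul trmxK Gs mulmxA.
Qed.

End BilTheory.

Section DoubleIntegral.
Variables (R : realType) (d : nat).
Local Open Scope ereal_scope.
Let L := lebesgue_model R d.
Let T := lm_T L.
Let mu := lm_mu L.
Implicit Types F : 'rV[R]_d -> 'rV[R]_d -> R.

Definition jointly_measurable F :=
  measurable_fun setT (fun z : T * T => F (lm_vec z.1) (lm_vec z.2)).

Definition double_int F : \bar R :=
  \int[sf_prod mu mu]_(z in [set: T * T]) (F (lm_vec z.1) (lm_vec z.2))%:E.

Lemma double_intE F : jointly_measurable F -> (forall x y, 0 <= F x y)%R ->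
  double_int F =
  \int[mu]_(x in [set: T]) \int[mu]_(y in [set: T]) (F (lm_vec x) (lm_vec y))%:E.
Proof.
move=> mF F0; rewrite /double_int /sf_prod fubini_tonelli1 //.
by apply/measurable_EFinP.
by move=> z; rewrite lee_fin.
Qed.

Lemma double_int_iint F : jointly_measurable F -> (forall x y, 0 <= F x y)%R ->
  iint (fun x => iint (fun y => (F x y)%:E)) = double_int F.
Proof.
move=> mF F0; rewrite double_intE // (@iint2 R d (fun x y => (F x y)%:E)) //.
by apply/measurable_EFinP.
Qed.

Lemma jointly_measurable_shift F (a b : 'rV[R]_d) : jointly_measurable F ->
  jointly_measurable (fun x y => F (x + a) (y + b))%R.
Proof.
move=> mF; rewrite /jointly_measurable.
(* The model space carries no addition, so the translation passes to vectors by [lm_vec] and back by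
   [lm_pt]. *)
pose g (z : T * T) : T * T := (lm_pt L (lm_vec z.1 + a), lm_pt L (lm_vec z.2 + b))%R.
have mg : measurable_fun setT g.
  have mv (c : 'rV[R]_d) (p : T * T -> T) : measurable_fun setT p ->
      measurable_fun setT (fun z => lm_pt L (lm_vec (p z) + c)%R).
    move=> mp; apply: (lm_mpt (g := fun z => lm_vec (p z) + c)%R) => i.
    rewrite [X in measurable_fun _ X](_ : _ = fun z => (lm_vec (p z) 0 i + c 0 i)%R).
      by apply: measurable_funD => //; exact: (measurableT_comp (lm_mvec i) mp).
    by apply/funext => z; rewrite mxE.
  by apply: measurable_fun_pair; apply: mv; [exact: measurable_fst|exact: measurable_snd].
rewrite [X in measurable_fun _ X](_ : _ =
  (fun z : T * T => F (lm_vec z.1) (lm_vec z.2)) \o g).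
  exact: measurableT_comp mF mg.
by apply/funext => z /=; rewrite !lm_ptK.
Qed.

Lemma double_int_shift F (a b : 'rV[R]_d) : jointly_measurable F ->
  (forall x y, 0 <= F x y)%R ->
  double_int (fun x y => F (x + a) (y + b))%R = double_int F.
Proof.
move=> mF F0; rewrite !double_intE //; last exact: jointly_measurable_shift.
have mE : measurable_fun setT (fun z : T * T => (F (lm_vec z.1) (lm_vec z.2))%:E).
  exact/measurable_EFinP.
have inner x : \int[mu]_(y in [set: T]) (F x (lm_vec y + b)%R)%:E =
    \int[mu]_(y in [set: T]) (F x (lm_vec y))%:E.
  apply: (lm_shift (l := L) b (f := fun y => (F x y)%:E)).
    by move=> y; rewrite lee_fin.
  rewrite -(lm_ptK L x).
  exact: (measurableT_comp mE (measurable_pair1 (lm_pt L x))).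
under eq_integral => x _ do rewrite inner.
apply: (lm_shift (l := L) a (f := fun x => \int[mu]_(y in [set: T]) (F x (lm_vec y))%:E)).
  by move=> x; apply: integral_ge0 => y _; rewrite lee_fin.
apply: (@measurable_fun_fubini_tonelli_F _ _ _ _ R mu
  (fun z => (F (lm_vec z.1) (lm_vec z.2))%:E)) => // z.
by rewrite lee_fin.
Qed.

Lemma double_intZ F (c : R) : jointly_measurable F -> (forall x y, 0 <= F x y)%R ->
  (0 <= c)%R -> double_int (fun x y => c * F x y)%R = c%:E * double_int F.
Proof.
move=> mF F0 c0; rewrite /double_int -ge0_integralZl //.
- by apply/measurable_EFinP.
- by move=> z _; rewrite lee_fin.
Qed.

Lemma double_int_sum (I : finType) (F : I -> 'rV[R]_d -> 'rV[R]_d -> R) :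
  (forall i, jointly_measurable (F i)) -> (forall i x y, 0 <= F i x y)%R ->
  double_int (fun x y => \sum_i F i x y)%R = \sum_i double_int (F i).
Proof.
move=> mF F0; rewrite /double_int -ge0_integral_sum //.
- by apply: eq_integral => z _; rewrite sumEFin.
- by move=> i; apply/measurable_EFinP; exact: mF.
- by move=> i z _; rewrite lee_fin.
Qed.

End DoubleIntegral.

(** * Gaussian integrals and the sign of the form *)

Section Gaussian.
Variables (R : realType) (d : nat) (G : 'M[R]_d).
Hypothesis Gsym : G^T = G.
Local Open Scope ereal_scope.
Let L := lebesgue_model R d.
Let T := lm_T L.
Let mu := lm_mu L.

Definition gaussian (x : 'rV[R]_d) : R := expR (- bil G x x / 2).

Definition gaussian_mass : \bar R := \int[mu]_(x in [set: T]) (gaussian (lm_vec x))%:E.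

Lemma measurable_gaussian_shift d' (Z : measurableType d') (g : Z -> 'rV[R]_d) m :
  (forall i, measurable_fun setT (fun z => g z 0 i)%R) ->
  measurable_fun setT (fun z => gaussian (g z - m)).
Proof.
move=> mg; have mgm i : measurable_fun setT (fun z => (g z - m) 0 i)%R.
  rewrite [X in measurable_fun _ X](_ : _ = fun z => g z 0 i + - m 0 i)%R.
    exact: measurable_funD.
  by apply/funext => z; rewrite !mxE.
apply: (measurableT_comp (@measurable_expR R)).
apply: measurable_funM => //.
apply: (measurableT_comp (@oppr_measurable R setT)).
exact: measurable_bil.
Qed.

Lemma gaussian_mass_shift m :
  \int[mu]_(x in [set: T]) (gaussian (lm_vec x - m))%:E = gaussian_mass.
Proof.
apply: (lm_shift (l := L) (- m)%R (f := fun x => (gaussian x)%:E)).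
  by move=> x; rewrite lee_fin expR_ge0.
apply/measurable_EFinP.
have := @measurable_gaussian_shift _ T (fun x => lm_vec x) 0%R (@lm_mvec _ _ L).
by under eq_fun do rewrite subr0.
Qed.

Lemma gmixE k (w : 'I_k -> R) (M : 'M[R]_(k, d)) x :
  (gmix G w M x = \sum_(i < k) w i / Num.sqrt ((2 * pi) ^+ d) * gaussian (x - row i M))%R.
Proof. by []. Qed.

Lemma gmix_mass k (w : 'I_k -> R) (M : 'M[R]_(k, d)) :
  (forall i, 0 <= w i)%R -> (\sum_(i < k) w i = 1)%R ->
  iint (fun x => (gmix G w M x)%:E) = (Num.sqrt ((2 * pi) ^+ d))^-1%:E * gaussian_mass.
Proof.
move=> w0 w1; set S := Num.sqrt _.
have S0 : (0 <= S)%R by exact: sqrtr_ge0.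
have mg i : measurable_fun setT (fun x : T => gaussian (lm_vec x - row i M)).
  exact: measurable_gaussian_shift (@lm_mvec _ _ L).
have mt i : measurable_fun setT (fun x : T => w i / S * gaussian (lm_vec x - row i M))%R.
  by apply: measurable_funM.
rewrite (lm_iint (l := L)); first last.
- by apply/measurable_EFinP; apply: measurable_sum.
- move=> x; rewrite lee_fin; apply: sumr_ge0 => i _.
  by rewrite mulr_ge0 ?expR_ge0 // divr_ge0.
under eq_integral => x _ do rewrite gmixE -sumEFin.
rewrite ge0_integral_sum //; first last.
- by move=> i x _; rewrite lee_fin mulr_ge0 ?expR_ge0 // divr_ge0.
- by move=> i; apply/measurable_EFinP.
under eq_bigr => i _.
  under eq_integral => x _ do rewrite EFinM.
  rewrite ge0_integralZl //; first last.
  - by rewrite lee_fin divr_ge0.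
  - by move=> x _; rewrite lee_fin expR_ge0.
  - by apply/measurable_EFinP.
  rewrite gaussian_mass_shift.
  over.
rewrite -ge0_sume_distrl; last by move=> i _; rewrite lee_fin divr_ge0.
by rewrite sumEFin -mulr_suml w1 mul1r.
Qed.

(** By translation all components have the same integral, so the mixture has mass [gaussian_mass] /
    sqrt((2 pi)^d). As this is 1, [gaussian_mass] is finite and positive, which is not clear
    beforehand for an indefinite form. *)
Lemma gaussian_mass_density k (w : 'I_k -> R) (M : 'M[R]_(k, d)) :
  (forall i, 0 < w i)%R -> (\sum_(i < k) w i = 1)%R -> is_prob_density (gmix G w M) ->
  exists2 c : R, (0 < c)%R & gaussian_mass = c%:E.
Proof.
move=> w0 w1 [_]; rewrite gmix_mass // => [|i]; last exact: ltW.
set S := Num.sqrt _; have S0 : (0 < S)%R.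
  by rewrite sqrtr_gt0 exprn_gt0 // mulr_gt0 ?pi_gt0.
have : 0 <= gaussian_mass by apply: integral_ge0 => x _; rewrite lee_fin expR_ge0.
case: gaussian_mass => [c| |] //= _; last by rewrite gt0_muley // lte_fin invr_gt0.
move=> /eqP; rewrite -EFinM eqe => /eqP E; exists c => //.
have -> : c = S by rewrite -[c](mulVKf (lt0r_neq0 S0)) E mulr1.
exact: S0.
Qed.

(* Translating by u and by -u and averaging multiplies the integrand by
   exp(- <u,u> / 2) cosh <x,u>. *)
Lemma bil_ge0 (c : R) u : (0 < c)%R -> gaussian_mass = c%:E -> (0 <= bil G u u)%R.
Proof.
move=> c0 cE; rewrite leNgt; apply/negP => u0.
have mg m : measurable_fun setT (fun x : T => (gaussian (lm_vec x - m))%:E).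
  by apply/measurable_EFinP; exact: measurable_gaussian_shift (@lm_mvec _ _ L).
have g0 m (x : T) : 0 <= (gaussian (lm_vec x - m))%:E by rewrite lee_fin expR_ge0.
have mg0 : measurable_fun setT (fun x : T => (gaussian (lm_vec x))%:E).
  by have := mg 0%R; under eq_fun do rewrite subr0.
(* As cosh >= 1, the two translates together dominate 2 exp(- <u,u> / 2) times the Gaussian. All
   have the same finite positive mass, so exp(- <u,u> / 2) <= 1, which fails for <u,u> < 0. *)
have : gaussian_mass + gaussian_mass >= (2 * expR (- bil G u u / 2))%:E * gaussian_mass.
  rewrite -{2}(gaussian_mass_shift u) -{2}(gaussian_mass_shift (- u)).
  rewrite -ge0_integralD // -ge0_integralZl //; last by move=> x _; rewrite lee_fin expR_ge0.
  apply: ge0_le_integral => //.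
  - by move=> x _; rewrite mule_ge0 // lee_fin ?mulr_ge0 ?expR_ge0.
  - exact: measurable_funeM.
  - exact: emeasurable_funD.
  move=> x _; rewrite -EFinM -EFinD lee_fin /gaussian.
  rewrite !(bilDl, bilDr, bilNl, bilNr, opprK) (bilC u (lm_vec x) Gsym).
  set X := bil G (lm_vec x) (lm_vec x); set Y := bil G (lm_vec x) u; set U := bil G u u.
  have -> : (- (X - Y + (- Y + U)) / 2 = - U / 2 + (- X / 2 + Y))%R by field.
  have -> : (- (X + Y + (Y + U)) / 2 = - U / 2 + (- X / 2 - Y))%R by field.
  rewrite !expRD -!mulrDr -mulrA mulrCA ler_wpM2l ?expR_ge0 //.
  rewrite mulrC ler_wpM2l ?expR_ge0 //.
  have := expR_ge1Dx Y; have := expR_ge1Dx (- Y); lra.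
rewrite cE -EFinM -EFinD lee_fin => h.
have e1 : (1 < expR (- bil G u u / 2))%R by rewrite expR_gt1; lra.
by nra.
Qed.

End Gaussian.

(** * The Laplace transform of the squared distance *)

Section ExponentialSums.
Variables (R : realType) (I : finType).

(* Sampling at s = l h turns the hypothesis into an identity between the values
   of any polynomial p of bounded degree at the nodes exp (- h v); take p vanishing
   at all nodes but the one of c. *)
Lemma exp_sum_unique (e : R) (a b : I -> R) (x y : I -> R) : 0 < e ->
  (forall s, 0 <= s < e ->
    \sum_i a i * expR (- s * x i) = \sum_i b i * expR (- s * y i)) ->
  forall c, \sum_(i | x i == c) a i = \sum_(i | y i == c) b i.
Proof.
move=> e0 H c.
pose vals := [seq v <- [seq x i | i <- enum I] ++ [seq y i | i <- enum I] | v != c].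
(* The polynomial [p] has degree [size vals], so every sample l h that occurs stays below [e]. *)
pose h := e / (size vals).+2%:R.
have h0 : 0 < h by rewrite divr_gt0 // ltr0n.
pose p := \prod_(v <- vals) ('X - (expR (- h * v))%:P).
have sp : size p = (size vals).+1.
  by rewrite /p -(big_map (fun v => expR (- h * v)) predT (fun z => 'X - z%:P))
    size_prod_XsubC size_map.
have P (f g : I -> R) : \sum_i f i * p.[expR (- h * g i)] =
    \sum_(l < size p) p`_l * \sum_i f i * expR (- (l%:R * h) * g i).
  under eq_bigr => i _ do rewrite horner_coef mulr_sumr.
  rewrite exchange_big /=; apply: eq_bigr => l _; rewrite mulr_sumr.
  apply: eq_bigr => i _; rewrite mulrCA; congr (_ * (_ * _)).
  by rewrite -expRM_natl; congr expR; ring.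
have E : \sum_i a i * p.[expR (- h * x i)] = \sum_i b i * p.[expR (- h * y i)].
  rewrite !P; apply: eq_bigr => l _; rewrite H //.
  rewrite mulr_ge0 ?ler0n ?ltW //= /h mulrA ltr_pdivrMr ?ltr0n //.
  rewrite mulrC ltr_pM2l // ltr_nat.
  by apply: (leq_trans (ltn_ord l)); rewrite sp.
have pr v : v \in vals -> p.[expR (- h * v)] = 0.
  by move=> vv; rewrite /p horner_prod (big_rem v) //= !hornerE subrr mul0r.
have pc : p.[expR (- h * c)] != 0.
  rewrite /p horner_prod prodf_seq_neq0; apply/allP => v; rewrite mem_filter => /andP[vc _] /=.
  rewrite !hornerE subr_eq0; apply: contraNneq vc => /expR_inj/eqP.
  by rewrite !mulNr eqr_opp => /eqP /(mulfI (lt0r_neq0 h0)) ->.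
have Q (f g : I -> R) : (forall i, g i != c -> g i \in vals) ->
    \sum_i f i * p.[expR (- h * g i)] = (\sum_(i | g i == c) f i) * p.[expR (- h * c)].
  move=> gv; rewrite (bigID (fun i => g i == c)) /= [X in _ + X]big1 ?addr0.
    by rewrite mulr_suml; apply: eq_bigr => i /eqP ->.
  by move=> i gi; rewrite pr ?mulr0 // gv.
apply: (mulIf pc); rewrite -!Q //.
- by move=> i gi; rewrite mem_filter gi mem_cat map_f ?orbT ?mem_enum.
- by move=> i gi; rewrite mem_filter gi mem_cat map_f ?mem_enum.
Qed.

End ExponentialSums.

Section Laplace.
Variables (R : realType) (d : nat) (G : 'M[R]_d).
Hypothesis Gsym : G^T = G.
Local Open Scope ereal_scope.
Let L := lebesgue_model R d.
Let T := lm_T L.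
Let mu := lm_mu L.

Lemma jointly_measurable_dist d' (Z : measurableType d') (g h : Z -> 'rV[R]_d) :
  (forall i, measurable_fun setT (fun z => g z 0 i)%R) ->
  (forall i, measurable_fun setT (fun z => h z 0 i)%R) ->
  measurable_fun setT (fun z => bil G (g z - h z) (g z - h z))%R.
Proof.
move=> mg mh; have mgh i : measurable_fun setT (fun z => (g z - h z) 0 i)%R.
  rewrite [X in measurable_fun _ X](_ : _ = (fun z => g z 0 i) \- (fun z => h z 0 i))%R.
    exact: measurable_funB.
  by apply/funext => z; rewrite !mxE.
exact: measurable_bil.
Qed.

Let m1 i : measurable_fun setT (fun z : T * T => lm_vec z.1 0 i)%R.
Proof. exact: (measurableT_comp (lm_mvec i) measurable_fst). Qed.
Let m2 i : measurable_fun setT (fun z : T * T => lm_vec z.2 0 i)%R.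
Proof. exact: (measurableT_comp (lm_mvec i) measurable_snd). Qed.

Definition coupled (t : R) (a c x y : 'rV[R]_d) : R :=
  (gaussian G (x - a) * gaussian G (y - c) * expR (- t * bil G (x - y) (x - y)))%R.

Lemma measurable_exp_dist (t : R) :
  measurable_fun setT (fun z : T * T =>
    expR (- t * bil G (lm_vec z.1 - lm_vec z.2) (lm_vec z.1 - lm_vec z.2)))%R.
Proof.
apply: (measurableT_comp (@measurable_expR R)); apply: measurable_funM => //.
exact: jointly_measurable_dist.
Qed.

Lemma coupled_ge0 t a c x y : (0 <= coupled t a c x y)%R.
Proof. by rewrite !mulr_ge0 ?expR_ge0. Qed.

Lemma jointly_measurable_coupled t a c : jointly_measurable (coupled t a c).
Proof.
apply: measurable_funM; last exact: measurable_exp_dist.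
by apply: measurable_funM; exact: measurable_gaussian_shift.
Qed.

(* The exponent is minimal at x = a - r (a - c), y = c + r (a - c) with
   r = 2 t / (1 + 4 t), where it equals t / (1 + 4 t) <a - c, a - c>. *)
Lemma coupled_shift t a c x y : (0 <= t)%R ->
  coupled t a c (x + (a - (2 * t / (1 + 4 * t)) *: (a - c)))
    (y + (c + (2 * t / (1 + 4 * t)) *: (a - c))) =
  (expR (- (t / (1 + 4 * t)) * bil G (a - c) (a - c)) * coupled t 0 0 x y)%R.
Proof.
move=> t0; set r := (2 * t / _)%R; set w := r *: (a - c).
have t1 : (1 + 4 * t != 0)%R by rewrite gt_eqF //; lra.
rewrite /coupled /gaussian !subr0.
have -> : (x + (a - w) - a = x - w)%R by rewrite addrA addrAC addrK.
have -> : (y + (c + w) - c = y + w)%R by rewrite addrA addrAC addrK.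
have -> : (x + (a - w) - (y + (c + w)) = (x - y) + (a - c) - (w + w))%R.
  by rewrite !opprD !addrA; do !rewrite -?addrA; apply/rowP => i; rewrite !mxE; ring.
rewrite /w; move: (a - c)%R => u; rewrite -!expRD; congr expR.
rewrite !(bilDl, bilDr, bilNl, bilNr, bilZl, bilZr).
rewrite (bilC u x Gsym) (bilC u y Gsym) (bilC y x Gsym) /r.
by field.
Qed.

(** Translation invariance moves the means out of the integral; the remaining factor is common to
    all pairs of components. *)
Lemma double_int_coupled t a c : (0 <= t)%R -> double_int (coupled t a c) =
  (expR (- (t / (1 + 4 * t)) * bil G (a - c) (a - c)))%:E * double_int (coupled t 0 0).
Proof.
move=> t0; rewrite -double_intZ ?expR_ge0 //; last 2 first.
- exact: jointly_measurable_coupled.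
- exact: coupled_ge0.
rewrite -(double_int_shift (a - (2 * t / (1 + 4 * t)) *: (a - c))
  (c + (2 * t / (1 + 4 * t)) *: (a - c))); last 2 first.
- exact: jointly_measurable_coupled.
- exact: coupled_ge0.
by congr double_int; apply/funext => x; apply/funext => y; rewrite coupled_shift.
Qed.

(** Laplace transform at [s] of the discrete measure whose point masses are given by [pair_mass]. *)
Definition pair_laplace k (w : 'I_k -> R) (D : 'M[R]_k) (s : R) : R :=
  (\sum_(p : 'I_k * 'I_k) (w p.1 * w p.2) * expR (- s * D p.1 p.2))%R.

Lemma gmix_pairE k (w : 'I_k -> R) (M : 'M[R]_(k, d)) t x y :
  (gmix G w M x * gmix G w M y * expR (- t * bil G (x - y) (x - y)) =
  \sum_(p : 'I_k * 'I_k) ((Num.sqrt ((2 * pi) ^+ d))^-1 ^+ 2 * (w p.1 * w p.2)) *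
    coupled t (row p.1 M) (row p.2 M) x y)%R.
Proof.
rewrite -(pair_bigA _ (fun i j => (Num.sqrt ((2 * pi) ^+ d))^-1 ^+ 2 * (w i * w j) *
  coupled t (row i M) (row j M) x y))%R /= !gmixE -mulrA mulr_suml.
apply: eq_bigr => i _; rewrite mulr_suml mulr_sumr; apply: eq_bigr => j _.
rewrite /coupled; ring.
Qed.

Lemma laplace_gmix k (w : 'I_k -> R) (M : 'M[R]_(k, d)) t :
  (0 <= t)%R -> (forall i, 0 <= w i)%R ->
  double_int (fun x y => gmix G w M x * gmix G w M y * expR (- t * bil G (x - y) (x - y)))%R =
  ((Num.sqrt ((2 * pi) ^+ d))^-1 ^+ 2 *
    pair_laplace w (dist_mx G M) (t / (1 + 4 * t)))%:E * double_int (coupled t 0 0).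
Proof.
move=> t0 w0; set S2 := (_ ^+ 2)%R.
have cof (p : 'I_k * 'I_k) : (0 <= S2 * (w p.1 * w p.2))%R.
  by rewrite mulr_ge0 ?sqr_ge0 // mulr_ge0.
transitivity (double_int (fun x y => \sum_(p : 'I_k * 'I_k) (S2 * (w p.1 * w p.2)) *
    coupled t (row p.1 M) (row p.2 M) x y)%R).
  by congr double_int; apply/funext => x; apply/funext => y; rewrite gmix_pairE.
rewrite double_int_sum; last 2 first.
- move=> p; apply: measurable_funM => //; exact: jointly_measurable_coupled.
- by move=> p x y; rewrite mulr_ge0 ?coupled_ge0 ?cof.
under eq_bigr => p _.
  rewrite (double_intZ (jointly_measurable_coupled t _ _) (coupled_ge0 t _ _) (cof p)).
  rewrite double_int_coupled // muleA -EFinM.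
  over.
rewrite -ge0_sume_distrl; last first.
  by move=> p _; rewrite lee_fin !mulr_ge0 ?expR_ge0.
rewrite sumEFin; congr (_%:E * _); rewrite /pair_laplace mulr_sumr; apply: eq_bigr => p _.
by rewrite -[LHS]mulrA [dist_mx _ _ _ _]mxE.
Qed.

(* For t >= 0 the integrand is at most that for t = 0, as the form is nonnegative. *)
Lemma double_int_coupled_fin (c t : R) : (0 < c)%R -> gaussian_mass G = c%:E -> (0 <= t)%R ->
  exists2 K : R, K != 0%R & double_int (coupled t 0 0) = K%:E.
Proof.
move=> c0 cE t0.
have psd u : (0 <= bil G u u)%R by exact: bil_ge0 c0 cE.
have mF s := jointly_measurable_coupled s 0 0.
have mE s : measurable_fun setT
    (fun z : T * T => (coupled s 0 0 (lm_vec z.1) (lm_vec z.2))%:E).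
  by apply/measurable_EFinP; exact: mF.
have K0 : double_int (coupled 0 0 0) = (c * c)%:E.
  rewrite double_intE; [|exact: mF|exact: coupled_ge0].
  have cpE x y : coupled 0 0 0 x y = (gaussian G x * gaussian G y)%R.
    by rewrite /coupled !subr0 oppr0 mul0r expR0 mulr1.
  have mg : measurable_fun setT (fun x : T => (gaussian G (lm_vec x))%:E).
    apply/measurable_EFinP.
    have := @measurable_gaussian_shift _ _ G _ T (fun x => lm_vec x) 0%R (@lm_mvec _ _ L).
    by under eq_fun do rewrite subr0.
  under eq_integral => x _.
    under eq_integral => y _ do rewrite cpE EFinM.
    rewrite ge0_integralZl //; last 2 first.
    - by move=> y _; rewrite lee_fin expR_ge0.
    - by rewrite lee_fin expR_ge0.
    rewrite -/(gaussian_mass G) cE; over.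
  rewrite ge0_integralZr //; [|by move=> x _; rewrite lee_fin expR_ge0|by rewrite lee_fin ltW].
  by rewrite -/(gaussian_mass G) cE.
have Kge : 0 <= double_int (coupled t 0 0).
  by apply: integral_ge0 => z _; rewrite lee_fin coupled_ge0.
have Kle : double_int (coupled t 0 0) <= double_int (coupled 0 0 0).
  apply: ge0_le_integral => //; first by move=> z _; rewrite lee_fin coupled_ge0.
  move=> z _; rewrite lee_fin /coupled ler_wpM2l ?mulr_ge0 ?expR_ge0 //.
  by rewrite ler_expR oppr0 mul0r mulNr oppr_le0 mulr_ge0.
(* The integrand is strictly positive everywhere, so a zero integral would make the whole space
   null, and the integral at t = 0 would vanish as well. *)
have Kne : double_int (coupled t 0 0) != 0.
  apply/eqP => E0; move: K0.
  suff -> : double_int (coupled 0 0 0) = 0.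
    by move=> /eqP; rewrite eq_sym eqe mulf_eq0 orbb gt_eqF.
  pose f s (z : T * T) : \bar R := (coupled s 0 0 (lm_vec z.1) (lm_vec z.2))%:E.
  have fabs s : \int[sf_prod mu mu]_(z in [set: T * T]) `|f s z| = double_int (coupled s 0 0).
    by apply: eq_integral => z _; rewrite gee0_abs // lee_fin coupled_ge0.
  have ft : ae_eq (sf_prod mu mu) setT (f t) (cst 0).
    by apply/ae_eq_integral_abs => //; [exact: mE|rewrite fabs].
  rewrite -fabs; apply/ae_eq_integral_abs => //; first exact: mE.
  apply: filterS ft => z /= /(_ Logic.I) => fz _; exfalso.
  move: fz => /eqP; rewrite /f eqe gt_eqF //.
  by rewrite /coupled !mulr_gt0 ?expR_gt0.
move: Kge Kle Kne; rewrite K0; case: (double_int _) => [K| |] // _ _ Kne.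
by exists K => //; move: Kne; rewrite eqe.
Qed.

(** Equal laws have equal Laplace transforms at every t >= 0. Dividing by the common factor, which
    is finite and nonzero, gives equal exponential sums at s = t / (1 + 4 t), and [exp_sum_unique]
    reads off the masses. *)
Lemma same_delta_pair_mass k (w wb : 'I_k -> R) (M N : 'M[R]_(k, d)) :
  (forall i, 0 < w i)%R -> (\sum_(i < k) w i = 1)%R ->
  (forall i, 0 < wb i)%R ->
  is_prob_density (gmix G w M) ->
  same_delta_dist G (gmix G w M) (gmix G wb N) ->
  forall c, pair_mass w (dist_mx G M) c = pair_mass wb (dist_mx G N) c.
Proof.
move=> w0 w1 wb0 dens same.
have [c c0 cE] := gaussian_mass_density w0 w1 dens.
have gm0 (v : 'I_k -> R) (P : 'M[R]_(k, d)) x : (forall i, 0 < v i)%R -> (0 <= gmix G v P x)%R.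
  move=> v0; apply: sumr_ge0 => i _.
  by rewrite mulr_ge0 ?expR_ge0 // divr_ge0 ?sqrtr_ge0 // ltW.
have mgm (v : 'I_k -> R) (P : 'M[R]_(k, d)) :
    jointly_measurable (fun x y => gmix G v P x * gmix G v P y)%R.
  by apply: measurable_funM; apply: measurable_sum => i; apply: measurable_funM => //;
    exact: measurable_gaussian_shift.
pose D (z : T * T) := bil G (lm_vec z.1 - lm_vec z.2) (lm_vec z.1 - lm_vec z.2).
have mD : measurable_fun setT D by exact: jointly_measurable_dist.
pose F (v : 'I_k -> R) (P : 'M[R]_(k, d)) (z : T * T) :=
  (gmix G v P (lm_vec z.1) * gmix G v P (lm_vec z.2))%R.
have deltaE v P B : (forall i, 0 < v i)%R -> measurable B -> delta_prob G (gmix G v P) B =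
    \int[sf_prod mu mu]_(z in [set: T * T]) (F v P z * \1_B (D z))%:E.
  move=> v0 mB; apply: (@double_int_iint R d (fun x y => gmix G v P x * gmix G v P y *
    \1_B (bil G (x - y) (x - y)))%R).
    apply: measurable_funM; first exact: mgm.
    by apply: (measurableT_comp _ mD); exact: measurable_indic.
  by move=> x y; rewrite !mulr_ge0 ?gm0 // indicE.
have lap t : (0 <= t)%R ->
    pair_laplace w (dist_mx G M) (t / (1 + 4 * t)) =
    pair_laplace wb (dist_mx G N) (t / (1 + 4 * t)).
  move=> t0; have [K K0 KE] := double_int_coupled_fin c0 cE t0.
  have : double_int (fun x y => gmix G w M x * gmix G w M y *
        expR (- t * bil G (x - y) (x - y)))%R =
      double_int (fun x y => gmix G wb N x * gmix G wb N y *
        expR (- t * bil G (x - y) (x - y)))%R.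
    apply: (@integral_law_eq _ _ _ (sf_prod mu mu) D mD (F w M) (F wb N)
      (fun s => expR (- t * s)%R)).
    - exact: mgm.
    - by move=> z; rewrite mulr_ge0 ?gm0.
    - exact: mgm.
    - by move=> z; rewrite mulr_ge0 ?gm0.
    - by apply: (measurableT_comp (@measurable_expR R)); exact: measurable_funM.
    - by move=> x; rewrite expR_ge0.
    - move=> B mB; have := same B mB.
      by rewrite (deltaE w M B w0 mB) (deltaE wb N B wb0 mB).
  have w0' i : (0 <= w i)%R by exact: ltW.
  have wb0' i : (0 <= wb i)%R by exact: ltW.
  rewrite (laplace_gmix M t0 w0') (laplace_gmix N t0 wb0').
  rewrite KE; move: (pair_laplace w _ _) (pair_laplace wb _ _) => X Y.
  rewrite -!EFinM => -[] /(mulIf K0).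
  apply: mulfI.
  by rewrite expf_neq0 // invr_neq0 // gt_eqF // sqrtr_gt0 exprn_gt0 // mulr_gt0 ?pi_gt0.
(* The map t / (1 + 4 t) takes [0, oo) onto [0, 1/4), with inverse s / (1 - 4 s). *)
apply: (@exp_sum_unique R ('I_k * 'I_k)%type 4^-1) => [|s /andP[s0 s4]].
  by rewrite invr_gt0.
have s1 : (1 - 4 * s != 0)%R by rewrite gt_eqF //; lra.
have t0 : (0 <= s / (1 - 4 * s))%R by rewrite divr_ge0 //; lra.
have := lap _ t0.
have -> : (s / (1 - 4 * s) / (1 + 4 * (s / (1 - 4 * s))) = s)%R.
  by field; rewrite s1 /=; apply/eqP; lra.
by [].
Qed.

End Laplace.

(** * From matched components to equal densities *)

Lemma not_zero_locus1 (R : realType) (k d : nat) (p : mpoly.mpoly (k * d) R) (M : 'M[R]_(k, d)) :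
  ~ zero_locus [set p] M <-> mx_eval M p != 0.
Proof.
split=> [nz|pM z]; last by move: pM; rewrite /mx_eval z ?eqxx.
by apply/eqP => pM; apply: nz => _ ->.
Qed.

Theorem theorem4p3 (R : realType) (d k : nat) (G : 'M[R]_d) :
  G^T = G -> G \in unitmx -> (d + 2 <= k)%N ->
  forall w : 'I_k -> R, (forall i, 0 < w i) -> \sum_(i < k) w i = 1 ->
  exists S : set (mpoly.mpoly (k * d) R),
    (exists M0 : 'M[R]_(k, d), ~ zero_locus S M0) /\
    forall M : 'M[R]_(k, d), ~ zero_locus S M ->
      is_prob_density (gmix G w M) ->
      forall (wb : 'I_k -> R) (Mb : 'M[R]_(k, d)),
        (forall i, 0 < wb i) -> \sum_(i < k) wb i = 1 ->
        is_prob_density (gmix G wb Mb) ->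
        same_delta_dist G (gmix G w M) (gmix G wb Mb) ->
        exists (A : 'M[R]_d) (b : 'rV[R]_d),
          is_orth G A /\ forall x, gmix G w M x = gmix G wb Mb (x *m A + b).
Proof.
move=> Gs GU dk w w0 w1; case: (posnP d) => [d0|d0].
  (* For d = 0 the space is a point and both mixtures are the same constant; the polynomial 1
     excludes no configuration. *)
  subst d; exists [set 1]; split.
    by exists 0; apply/not_zero_locus1; rewrite /mx_eval mpoly.meval1 oner_neq0.
  move=> M _ _ wb Mb wb0 wb1 _ _; exists 1%:M, 0; split.
    by move=> u v; rewrite !mulmx1.
  have gE (v : 'I_k -> R) (N : 'M[R]_(k, 0)) x : \sum_(i < k) v i = 1 ->
      gmix G v N x = (Num.sqrt ((2 * pi) ^+ 0))^-1.
    move=> v1; rewrite /gmix; under eq_bigr => i _.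
      rewrite /bil [_ *m G]thinmx0 mul0mx mxE oppr0 mul0r expR0 mulr1; over.
    by rewrite -mulr_suml v1 mul1r.
  by move=> x; rewrite !gE.
have [p [[M0 M0p] pH]] := @generic_reconstruct R k d G Gs GU d0 dk.
exists [set p]; split; first by exists M0; apply/not_zero_locus1.
move=> M /not_zero_locus1 /pH H dens wb Mb wb0 _ _ same.
have mass := @same_delta_pair_mass R d G Gs k w wb M Mb w0 w1 wb0 dens same.
have [t [A [b [tinj AGA wE rE]]]] := H w wb Mb w0 wb0 mass.
have orthA : is_orth G A.
  move=> u v; rewrite /bil trmx_mul !mulmxA -(mulmxA u A) -(mulmxA u (A *m G)).
  by rewrite AGA.
(* Component [i] of the second mixture at [x *m A + b] equals component [t i] of the first at
   [x]. *)
exists A, b; split => // x; rewrite !gmixE (reindex_inj tinj); apply: eq_bigr => i _.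
rewrite wE rE; congr (_ * _); rewrite /gaussian.
have -> : x *m A + b - (row (t i) M *m A + b) = (x - row (t i) M) *m A.
  by rewrite mulmxBl opprD addrACA subrr addr0.
by rewrite orthA.
Qed.
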